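(* Let $(V,Y,\mathbf{1},\mathrm{T})$ be a vertex algebra in dimension $D$ (including $D=1$) and let $X\in\operatorname{End}V$. The following two conditions are equivalent: (i) $X$ is a local endomorphism of $V$, $X\mathbf{1}=0$, and $\bigl(e^{-\operatorname{ad}(\mathrm z\cdot\mathrm T)}X\bigr)a\in V[\mathrm z]$ for every $a\in V$; (ii) there is a linear map $X(\mathrm z)\colon V\to V[\mathrm z]$ such that $X(0)=X$ and $[X,Y(a,\mathrm z)]=Y(X(\mathrm z)a,\mathrm z)$ for all $a\in V$. Moreover, in either case $X(\mathrm z)=e^{-\operatorname{ad}(\mathrm z\cdot\mathrm T)}X$, so that $$[X,Y(a,\mathrm z)]=Y\bigl((e^{-\operatorname{ad}(\mathrm z\cdot\mathrm T)}X)a,\mathrm z\bigr)\quad\text{for all }a\in V.$$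
   Context: All vector spaces are complex superspaces; brackets denote supercommutators, e.g. $[X,Y(a,\mathrm z)]=XY(a,\mathrm z)-(-1)^{p_Xp_a}Y(a,\mathrm z)X$ with $p$ denoting parity. $\mathrm z=(z^1,\dots,z^D)$ is a vector of formal variables, $\mathrm z\cdot\mathrm w=\sum_\alpha z^\alpha w^\alpha$, $\mathrm z^2=\mathrm z\cdot\mathrm z$. $V[\![\mathrm z]\!]_{\mathrm z^2}$ denotes the space of series $(\mathrm z^2)^{-N}v(\mathrm z)$ with $v(\mathrm z)\in V[\![\mathrm z]\!]$, $N\in\mathbb Z_{\ge0}$ (similarly $V[\![\mathrm z,\mathrm w]\!]_{\mathrm z^2\mathrm w^2}$); for $D=1$ this is $V(\!(z)\!)$. A vertex algebra in dimension $D$ is a vector superspace $V$ with an even linear map $a\otimes b\mapsto Y(a,\mathrm z)b$, $V\otimes V\to V[\![\mathrm z]\!]_{\mathrm z^2}$, commuting even endomorphisms $T_1,\dots,T_D$ (write $\mathrm T=(T_1,\dots,T_D)$, $\mathrm z\cdot\mathrm T=\sum z^\alpha T_\alpha$), and an even vector $\mathbf 1$, such that: (a) locality: for all $a,b$ there is $N_{a,b}=N_{b,a}\in\mathbb Z_{\ge0}$ with $f_{a,b,c}(\mathrm z,\mathrm w):=((\mathrm z-\mathrm w)^2)^{N_{a,b}}Y(a,\mathrm z)Y(b,\mathrm w)c\in V[\![\mathrm z,\mathrm w]\!]_{\mathrm z^2\mathrm w^2}$ and $f_{a,b,c}(\mathrm z,\mathrm w)=(-1)^{p_ap_b}f_{b,a,c}(\mathrm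 w,\mathrm z)$ for all $c$; (b) translation covariance: $[T_\alpha,Y(a,\mathrm z)]=\partial_{z^\alpha}Y(a,\mathrm z)$; (c) vacuum: $T_\alpha\mathbf 1=0$, $Y(\mathbf 1,\mathrm z)a=a$, $Y(a,\mathrm z)\mathbf 1\in V[\![\mathrm z]\!]$ and $Y(a,\mathrm z)\mathbf 1|_{\mathrm z=0}=a$. For $D=1$ this is the usual (Borcherds) vertex algebra. A linear operator $X\in\operatorname{End}V$ is called local if for all $a,b\in V$ there is $N\in\mathbb Z_{\ge0}$ with $((\mathrm z-\mathrm w)^2)^{N}\bigl[[X,Y(a,\mathrm z)],Y(b,\mathrm w)\bigr]=0$. Here $e^{-\operatorname{ad}(\mathrm z\cdot\mathrm T)}X:=\sum_{k\ge0}\frac{(-1)^k}{k!}(\operatorname{ad}(\mathrm z\cdot\mathrm T))^kX\in(\operatorname{End}V)[\![\mathrm z]\!]$. *)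

(* Defs.v *)
(* Vertex algebras in dimension D (Bakalov--Nikolov style),
   formal series in D variables localized at z^2, represented by
   representatives (N, f) meaning (z^2)^{-N} f, f in V[[z]]. *)
From HB Require Import structures.
From mathcomp Require Import all_boot all_order all_algebra.
Set Implicit Arguments.
Unset Strict Implicit.
Unset Printing Implicit Defensive.
Import Order.TTheory GRing.Theory Num.Theory.
Local Open Scope ring_scope.

Section MultiIndex.
Variable D : nat.
Definition mi := {ffun 'I_D -> nat}.
Definition mi0 : mi := [ffun => 0%N].
Definition mi_e (a : 'I_D) : mi := [ffun i => nat_of_bool (i == a)].
Definition mi_le (k m : mi) : bool := [forall i, (k i <= m i)%N].
Definition mi_sub (m k : mi) : mi := [ffun i => (m i - k i)%N].
Definition mi_add (m k : mi) : mi := [ffun i => (m i + k i)%N].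
Definition mi_scale (n : nat) (m : mi) : mi := [ffun i => (n * m i)%N].
Definition mi_deg (m : mi) : nat := (\sum_i m i)%N.
End MultiIndex.

Section Series.
Variables (D : nat) (W : zmodType).

(* f m = coefficient of z^m *)
Definition ps := mi D -> W.
Definition ps_eq (f g : ps) := forall m, f m = g m.
Definition ps_shift (k : mi D) (f : ps) : ps :=
  fun m => if mi_le k m then f (mi_sub m k) else 0.
(* multiplication by z^2 = sum_a (z^a)^2 *)
Definition ps_z2 (f : ps) : ps :=
  fun m => \sum_(a : 'I_D) ps_shift (mi_scale 2 (mi_e a)) f m.
Definition ps_deriv (a : 'I_D) (f : ps) : ps :=
  fun m => f (mi_add m (mi_e a)) *+ (m a).+1.

(* (N, f) represents (z^2)^{-N} f, an element of W[[z]]_{z^2} *)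
Definition loc := (nat * ps)%type.
Definition loc_eq (x y : loc) :=
  ps_eq (iter y.1 ps_z2 x.2) (iter x.1 ps_z2 y.2).
Definition loc0 : loc := (0%N, fun _ => 0).
Definition loc_add (x y : loc) : loc :=
  ((x.1 + y.1)%N, fun m => iter y.1 ps_z2 x.2 m + iter x.1 ps_z2 y.2 m).
Definition loc_map (F : W -> W) (x : loc) : loc := (x.1, fun m => F (x.2 m)).
Definition loc_sub (x y : loc) : loc := loc_add x (loc_map (fun v => - v) y).
Definition loc_shift (k : mi D) (x : loc) : loc := (x.1, ps_shift k x.2).
(* d/dz^a ((z^2)^{-N} f) = (z^2)^{-N-1} (z^2 d f - 2 N z^a f) *)
Definition loc_deriv (a : 'I_D) (x : loc) : loc :=
  (x.1.+1, fun m => ps_z2 (ps_deriv a x.2) m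
                    - ps_shift (mi_e a) x.2 m *+ (2 * x.1)).

(* Iterated series (W[[u]]_{u^2})[[v]]_{v^2}: (M, h) represents
   (v^2)^{-M} sum_p v^p h(p), h(p) in W[[u]]_{u^2}
   (u = inner variable, v = outer variable). *)
Definition iser := (nat * (mi D -> loc))%type.
Definition it_z2 (h : mi D -> loc) : mi D -> loc :=
  fun p => \big[loc_add/loc0]_(a : 'I_D)
     (if mi_le (mi_scale 2 (mi_e a)) p
      then h (mi_sub p (mi_scale 2 (mi_e a))) else loc0).
Definition it_eq (x y : iser) :=
  forall p, loc_eq (iter y.1 it_z2 x.2 p) (iter x.1 it_z2 y.2 p).
Definition it0 : iser := (0%N, fun _ => loc0).
Definition it_add (x y : iser) : iser :=
  ((x.1 + y.1)%N,
   fun p => loc_add (iter y.1 it_z2 x.2 p) (iter x.1 it_z2 y.2 p)).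
(* multiplication by (u - v)^2 = sum_a ((u^a)^2 - 2 u^a v^a + (v^a)^2) *)
Definition it_cross (h : mi D -> loc) : mi D -> loc :=
  fun p => \big[loc_add/loc0]_(a : 'I_D)
    loc_add
      (loc_add (loc_shift (mi_scale 2 (mi_e a)) (h p))
         (if mi_le (mi_e a) p
          then loc_map (fun v => - (v *+ 2))
                 (loc_shift (mi_e a) (h (mi_sub p (mi_e a))))
          else loc0))
      (if mi_le (mi_scale 2 (mi_e a)) p
       then h (mi_sub p (mi_scale 2 (mi_e a))) else loc0).
Definition it_crossN (N : nat) (x : iser) : iser := (x.1, iter N it_cross x.2).

(* Two-variable series: (L, G) represents (z^2 w^2)^{-L} G(z,w),
   G m p = coefficient of z^m w^p; element of W[[z,w]]_{z^2 w^2}. *)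
Definition ps2 := mi D -> mi D -> W.
Definition ps2_eq (G H : ps2) := forall m p, G m p = H m p.
Definition ps2_z2w2 (G : ps2) : ps2 :=
  fun m p => ps_z2 (fun m' => ps_z2 (G m') p) m.
Definition ps2_swap (G : ps2) : ps2 := fun m p => G p m.
(* embedding of W[[z,w]]_{z^2w^2} into (W[[z]]_{z^2})[[w]]_{w^2} *)
Definition emb_w (L : nat) (G : ps2) : iser :=
  (L, fun p => (L, fun m => G m p)).
(* embedding of W[[z,w]]_{z^2w^2} into (W[[w]]_{w^2})[[z]]_{z^2} *)
Definition emb_z (L : nat) (G : ps2) : iser :=
  (L, fun m => (L, fun p => G m p)).
End Series.

Section VertexAlgebra.
Variables (K : fieldType) (V : lmodType K) (D : nat).
Local Notation loc := (loc D V).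
Local Notation iser := (iser D V).

(* The super structure V = V_0 (+) V_1 is encoded by the parity
   operator P (P = 1 on V_0, P = -1 on V_1), a linear involution. *)
Definition is_parity (P : {linear V -> V}) := forall v, P (P v) = v.
Definition psign (i : bool) : K := if i then -1 else 1.
Definition homog (P : {linear V -> V}) (i : bool) (v : V) := P v = psign i *: v.
Definition par (P : {linear V -> V}) (i : bool) (v : V) : V :=
  2%:R^-1 *: (v + psign i *: P v).
Definition opar (P : {linear V -> V}) (i : bool) (X : V -> V) : V -> V :=
  fun v => 2%:R^-1 *: (X v + psign i *: P (X (P v))).
Definition ssign (i j : bool) : K := if i && j then -1 else 1.
Definition even_op (P : {linear V -> V}) (X : V -> V) := forall v, X (P v) = P (X v).

Variables (P : {linear V -> V}) (T : 'I_D -> {linear V -> V})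
          (Y : V -> V -> loc) (one : V).

(* Y(a,z)Y(b,w)c in (V[[z]]_{z^2})[[w]]_{w^2} *)
Definition YY (a b c : V) : iser :=
  let y := Y b c in (y.1, fun p => Y a (y.2 p)).

Definition is_vertex_algebra : Prop :=
  is_parity P /\
  (forall (k : K) a a' b,
     loc_eq (Y (k *: a + a') b) (loc_add (loc_map ( *:%R k) (Y a b)) (Y a' b))) /\
  (forall (k : K) a b b',
     loc_eq (Y a (k *: b + b')) (loc_add (loc_map ( *:%R k) (Y a b)) (Y a b'))) /\
  (forall a b, loc_eq (Y (P a) (P b)) (loc_map P (Y a b))) /\
  (forall al be v, T al (T be v) = T be (T al v)) /\
  (forall al, even_op P (T al)) /\
  (forall (i j : bool) a b, homog P i a -> homog P j b ->
     exists N : nat, forall c, exists L G L' G',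
       [/\ it_eq (it_crossN N (YY a b c)) (emb_w L G),
           it_eq (it_crossN N (YY b a c)) (emb_w L' G') &
           ps2_eq (iter L' (@ps2_z2w2 D V) G)
                  (fun m p => ssign i j *: iter L (@ps2_z2w2 D V) (ps2_swap G') m p)]) /\
  (forall al a b,
     loc_eq (loc_sub (loc_map (T al) (Y a b)) (Y a (T al b)))
            (loc_deriv al (Y a b))) /\
  P one = one /\
  (forall al, T al one = 0) /\
  (forall a, loc_eq (Y one a) (0%N, fun m => if m == mi0 D then a else 0)) /\
  (forall a, exists f, loc_eq (Y a one) (0%N, f) /\ f (mi0 D) = a).

(* [X, Y(a,z)] b, supercommutator extended bilinearly *)
Definition brXY_k (X : V -> V) (k : bool) (a b : V) : loc :=
  \big[@loc_add D V/@loc0 D V]_(i : bool) \big[@loc_add D V/@loc0 D V]_(j : bool | addb i j == k)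
    loc_sub (loc_map (opar P i X) (Y (par P j a) b))
            (loc_map ( *:%R (ssign i j)) (Y (par P j a) (opar P i X b))).
Definition brXY (X : V -> V) (a b : V) : loc :=
  \big[@loc_add D V/@loc0 D V]_(i : bool) \big[@loc_add D V/@loc0 D V]_(j : bool)
    loc_sub (loc_map (opar P i X) (Y (par P j a) b))
            (loc_map ( *:%R (ssign i j)) (Y (par P j a) (opar P i X b))).

(* X is local:  ((z-w)^2)^N [[X, Y(a,z)], Y(b,w)] = 0, i.e. for every c,
   ((z-w)^2)^N [X,Y(a,z)] Y(b,w) c  and
   ((z-w)^2)^N sum_{k,l} (-1)^{kl} Y(b_l,w) [X,Y(a,z)]_k c
   are (the expansions of) one and the same element of V[[z,w]]_{z^2w^2}. *)
Definition term1 (X : V -> V) (a b c : V) : iser :=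
  let y := Y b c in (y.1, fun p => brXY X a (y.2 p)).
Definition term2 (X : V -> V) (a b c : V) : iser :=
  \big[@it_add D V/@it0 D V]_(k : bool) \big[@it_add D V/@it0 D V]_(l : bool)
    (let x := brXY_k X k a c in
     (x.1, fun m => loc_map ( *:%R (ssign k l)) (Y (par P l b) (x.2 m)))).
Definition local_op (X : V -> V) : Prop :=
  forall a b, exists N : nat, forall c, exists L G,
    it_eq (it_crossN N (term1 X a b c)) (emb_w L G) /\
    it_eq (it_crossN N (term2 X a b c)) (emb_z L G).

(* e^{-ad(z.T)} X = sum_m z^m (-1)^{|m|}/m! ad(T_1)^{m_1}...ad(T_D)^{m_D} X *)
Definition adT (al : 'I_D) (F : V -> V) : V -> V := fun v => T al (F v) - F (T al v).
Definition ads (m : mi D) (F : V -> V) : V -> V :=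
  foldr (fun al G => iter (m al) (adT al) G) F (enum 'I_D).
Definition expad (X : V -> V) (m : mi D) : V -> V :=
  fun v => ((-1) ^+ mi_deg m / ((\prod_i (m i)`!)%N)%:R) *: ads m X v.

(* Y(p(z), z) b for a polynomial p(z) = sum_m z^m p_m with all m_i <= n *)
Definition mk_mi (n : nat) (k : {ffun 'I_D -> 'I_n.+1}) : mi D :=
  [ffun i => nat_of_ord (k i)].
Definition Ypoly (p : mi D -> V) (n : nat) (b : V) : loc :=
  \big[@loc_add D V/@loc0 D V]_(k : {ffun 'I_D -> 'I_n.+1})
     loc_shift (mk_mi k) (Y (p (mk_mi k)) b).

Definition cond_i (X : {linear V -> V}) : Prop :=
  [/\ local_op X, X one = 0 &
      forall a, exists n : nat, forall m, (n < mi_deg m)%N -> expad X m a = 0].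

Definition is_Xz (X : {linear V -> V}) (Xz : V -> mi D -> V) : Prop :=
  [/\ forall m (k : K) u v, Xz (k *: u + v) m = k *: Xz u m + Xz v m,
      forall a, Xz a (mi0 D) = X a &
      forall a, exists n : nat,
        (forall m, (n < mi_deg m)%N -> Xz a m = 0) /\
        (forall b, loc_eq (brXY X a b) (Ypoly (Xz a) n b))].

Definition cond_ii (X : {linear V -> V}) : Prop := exists Xz, is_Xz X Xz.

End VertexAlgebra.

(* Main.v *)
Require Import Defs.
From HB Require Import structures.
From mathcomp Require Import all_boot all_order all_algebra.
From mathcomp Require Import zify boolp functions generic_quotient.

(** Write E(z) = e^{-ad(z.T)} X.  Translation covariance gives Y(a,z)1 = e^{z.T} a, hence
    [X, Y(a,z)] 1 = X e^{z.T} a = e^{z.T} E(z) a = Y(E(z) a, z) 1 as soon as X 1 = 0.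
    - (i) => (ii): for E(z) a polynomial, [X, Y(a,z)] and Y(E(z) a, z) are both local with
      respect to every Y(b,w) and agree on the vacuum, so they coincide (Goddard's argument).
    - (ii) => (i): [X, Y(a,z)] = Y(X(z) a, z) is a finite combination of fields of the
      vertex algebra, so X is local; a = 1 gives X 1 = 0; and the displayed identity
      determines X(z) = E(z) since p(z) |-> Y(p(z),z)1 = e^{z.T} p(z) is injective. *)

Set Implicit Arguments.
Unset Strict Implicit.
Unset Printing Implicit Defensive.
Import Order.TTheory GRing.Theory Num.Theory.
Local Open Scope ring_scope.

(** * Multi-indices and power series *)

(** Fractions (N, f) are compared by clearing denominators. This is an equivalence because z^2 is a
    nonzerodivisor on V[[z]], which requires D > 0: for D = 0 the empty sum makes z^2 vanish. Hence
    the quotient module [Loc] over D = d.+1, where identities of series become linear algebra, with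
    iterated series obtained by applying [Loc] twice. The products Y(a,z)Y(b,w)c and Y(b,w)Y(a,z)c
    live in different iterated spaces, so locality is not an equation but a relation, [same_series]:
    both come from one two-variable fraction. Goddard's argument then rests on two cancellations:
    either member of the relation determines the other, and (z-w)^2 is injective on iterated series.
    The exponentials are handled through their constant terms and first-order differential
    equations, solved coefficient by coefficient in characteristic zero. Locality of X involves the
    parity components of [X, Y(a,z)], while the commutator formula concerns the whole bracket; the
    components are recovered by conjugating with P. *)

Section MultiIndices.
Variable D : nat.
Implicit Types (k l m : mi D) (a : 'I_D).

Lemma mi_leP k m : reflect (forall i, (k i <= m i)%N) (mi_le k m).
Proof. exact: forallP. Qed.

Lemma mi_le0 m : mi_le (mi0 D) m.
Proof. by apply/mi_leP => i; rewrite ffunE. Qed.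

Lemma mi_addC k l : mi_add k l = mi_add l k.
Proof. by apply/ffunP => i; rewrite !ffunE addnC. Qed.

Lemma mi_sub0 m : mi_sub m (mi0 D) = m.
Proof. by apply/ffunP => i; rewrite !ffunE subn0. Qed.

Lemma mi_subKC k m : mi_le k m -> mi_add k (mi_sub m k) = m.
Proof. by move=> /mi_leP h; apply/ffunP => i; rewrite !ffunE subnKC. Qed.

Lemma mi_addKC k m : mi_sub (mi_add k m) k = m.
Proof. by apply/ffunP => i; rewrite !ffunE addKn. Qed.

Lemma mi_le_add k l m : mi_le (mi_add k l) m = mi_le k m && mi_le l (mi_sub m k).
Proof.
apply/mi_leP/andP => [h | [/mi_leP h /mi_leP g] i].
  by split; apply/mi_leP => i; have := h i; rewrite !ffunE; lia.
by have := h i; have := g i; rewrite !ffunE; lia.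
Qed.

Lemma mi_subA m k l : mi_sub (mi_sub m k) l = mi_sub m (mi_add k l).
Proof. by apply/ffunP => i; rewrite !ffunE subnDA. Qed.

Lemma mi_degD k l : mi_deg (mi_add k l) = (mi_deg k + mi_deg l)%N.
Proof. by rewrite /mi_deg -big_split; apply: eq_bigr => i _; rewrite ffunE. Qed.

Lemma mi_deg_e a : mi_deg (mi_e a) = 1%N.
Proof.
rewrite /mi_deg (bigD1 a) //= ffunE eqxx big1 // => i ia.
by rewrite ffunE (negPf ia).
Qed.

Lemma mi_deg_scale n m : mi_deg (mi_scale n m) = (n * mi_deg m)%N.
Proof. by rewrite /mi_deg big_distrr; apply: eq_bigr => i _; rewrite ffunE. Qed.

Lemma mi_deg_sub k m : mi_le k m -> mi_deg (mi_sub m k) = (mi_deg m - mi_deg k)%N.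
Proof. by move=> h; rewrite -{2}(mi_subKC h) mi_degD addKn. Qed.

Lemma mi_le_deg k m : mi_le k m -> (mi_deg k <= mi_deg m)%N.
Proof. by move=> /mi_leP h; apply: leq_sum => i _; apply: h. Qed.

Lemma leq_mi_deg m i : (m i <= mi_deg m)%N.
Proof. by rewrite /mi_deg (bigD1 i) //= leq_addr. Qed.

Lemma mi_deg_eq0 m : mi_deg m = 0%N -> m = mi0 D.
Proof.
by move=> h; apply/ffunP => i; apply/eqP; have := leq_mi_deg m i; rewrite h leqn0 ffunE.
Qed.

Lemma mi_e_le a m : mi_le (mi_e a) m = (0 < m a)%N.
Proof.
apply/mi_leP/idP => [/(_ a) | h i]; rewrite !ffunE ?eqxx //.
by case: eqP => [->|].
Qed.

(** The induction suited to first-order systems: the coefficient at m + e_a is read off the a-th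
    partial derivative at m. *)
Lemma mi_ind (Q : mi D -> Prop) :
  Q (mi0 D) -> (forall m a, Q m -> Q (mi_add m (mi_e a))) -> forall m, Q m.
Proof.
move=> Q0 QS m; move: {2}(mi_deg m) (erefl (mi_deg m)) => n.
elim: n m => [|n IHn] m hm; first by rewrite (mi_deg_eq0 hm).
have [a ha]: exists a, (0 < m a)%N.
  apply/existsP; apply: contraT; rewrite negb_exists => /forallP h.
  by move: hm; rewrite /mi_deg big1 // => i _; have := h i; lia.
rewrite -mi_e_le in ha; rewrite -(mi_subKC ha) mi_addC; apply/QS/IHn.
by rewrite mi_deg_sub // mi_deg_e hm subn1.
Qed.

End MultiIndices.

Section PowerSeries.
Variables (K : fieldType) (D : nat).
Implicit Types (W : lmodType K) (k l m : mi D).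

Lemma fct_Mn W (f : ps D W) n m : (f *+ n) m = f m *+ n.
Proof. by elim: n => [|n IHn]; rewrite ?mulr0n // !mulrS -IHn. Qed.

Fact ps_shift_is_linear W k : linear (@ps_shift D W k : ps D W -> ps D W).
Proof.
move=> c f g; apply/funext => m.
rewrite /ps_shift !fctE; case: ifP => //; rewrite scaler0 addr0 //.
Qed.
HB.instance Definition _ W k := GRing.isLinear.Build K (ps D W) (ps D W) *:%R
  (@ps_shift D W k) (@ps_shift_is_linear W k).

Lemma ps_shiftA W k l (f : ps D W) :
  ps_shift k (ps_shift l f) = ps_shift (mi_add k l) f.
Proof.
apply/funext => m; rewrite /ps_shift mi_le_add mi_subA.
by case: (mi_le k m).
Qed.

Lemma ps_shiftC W k l (f : ps D W) :
  ps_shift k (ps_shift l f) = ps_shift l (ps_shift k f).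
Proof. by rewrite !ps_shiftA mi_addC. Qed.

Lemma ps_z2E W (f : ps D W) :
  ps_z2 f = \sum_(a : 'I_D) ps_shift (mi_scale 2 (mi_e a)) f.
Proof. by rewrite fct_sumE. Qed.

Fact ps_z2_is_linear W : linear (@ps_z2 D W : ps D W -> ps D W).
Proof.
move=> c f g; rewrite !ps_z2E scaler_sumr -big_split.
by apply: eq_bigr => a _; rewrite linearP.
Qed.
HB.instance Definition _ W := GRing.isLinear.Build K (ps D W) (ps D W) *:%R
  (@ps_z2 D W) (@ps_z2_is_linear W).

Lemma ps_z2_shift W k (f : ps D W) : ps_z2 (ps_shift k f) = ps_shift k (ps_z2 f).
Proof.
by rewrite !ps_z2E linear_sum; apply: eq_bigr => a _; rewrite ps_shiftC.
Qed.

Definition ps_map W W' (F : W -> W') (f : ps D W) : ps D W' := fun m => F (f m).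

Fact ps_map_is_linear W W' (F : {linear W -> W'}) :
  linear (ps_map F : ps D W -> ps D W').
Proof. by move=> c f g; apply/funext => m; rewrite /ps_map !fctE linearP. Qed.
HB.instance Definition _ W W' (F : {linear W -> W'}) :=
  GRing.isLinear.Build K (ps D W) (ps D W') *:%R (ps_map F) (ps_map_is_linear F).

Lemma ps_map_shift W W' (F : {linear W -> W'}) k (f : ps D W) :
  ps_map F (ps_shift k f) = ps_shift k (ps_map F f).
Proof.
by apply/funext => m; rewrite /ps_map /ps_shift; case: ifP => // _; rewrite linear0.
Qed.

Lemma ps_map_z2 W W' (F : {linear W -> W'}) (f : ps D W) :
  ps_map F (ps_z2 f) = ps_z2 (ps_map F f).
Proof.
by rewrite !ps_z2E linear_sum; apply: eq_bigr => a _; exact: ps_map_shift.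
Qed.

Fact iter_is_linear W (F : {linear W -> W}) n : linear (iter n F).
Proof. by move=> c u v; elim: n => //= n ->; rewrite linearP. Qed.
HB.instance Definition _ W (F : {linear W -> W}) n :=
  GRing.isLinear.Build K W W *:%R (iter n F) (iter_is_linear F n).

Lemma iter_comm (T T' : Type) (A : T -> T') (B : T -> T) (C : T' -> T') n :
  (forall x, A (B x) = C (A x)) -> forall x, A (iter n B x) = iter n C (A x).
Proof. by move=> h x; elim: n => //= n <-. Qed.

(** Leibniz rule for z^k f; the second summand is the derivative of z^k times f. *)
Lemma ps_deriv_shift W (al : 'I_D) k (f : ps D W) :
  ps_deriv al (ps_shift k f) =
  ps_shift k (ps_deriv al f) +
  (if (0 < k al)%N then ps_shift (mi_sub k (mi_e al)) f *+ k al else 0).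
Proof.
apply/funext => m; rewrite fctE /ps_deriv /ps_shift.
have -> (b : bool) (g : ps D W) :
    (if b then g *+ k al else 0) m = if b then g m *+ k al else 0.
  by case: b; rewrite // fct_Mn.
case: (boolP (mi_le k m)) => km.
  have km' : mi_le k (mi_add m (mi_e al)).
    by apply/mi_leP => i; rewrite !ffunE; have /mi_leP/(_ i) := km; lia.
  have -> : mi_sub (mi_add m (mi_e al)) k = mi_add (mi_sub m k) (mi_e al).
    by apply/ffunP => i; rewrite !ffunE; have /mi_leP/(_ i) := km; lia.
  rewrite km' ffunE; case: ifP => hk; last first.
    by rewrite addr0; congr (_ *+ _); lia.
  have -> : mi_le (mi_sub k (mi_e al)) m.
    by apply/mi_leP => i; rewrite !ffunE; have /mi_leP/(_ i) := km; lia.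
  have -> : mi_sub m (mi_sub k (mi_e al)) = mi_add (mi_sub m k) (mi_e al).
    apply/ffunP => i; rewrite !ffunE; have /mi_leP/(_ i) := km.
    by case: eqP => [->|]; lia.
  by rewrite -mulrnDr; congr (_ *+ _); have /mi_leP/(_ al) := km; lia.
rewrite add0r.
case: ifP => km1; last first.
  rewrite mul0rn; case: ifP => // hk; case: ifP => [/mi_leP km2|]; last by rewrite mul0rn.
  by case/mi_leP: km1 => i; have := km2 i; rewrite !ffunE; lia.
(* Boundary case: z^k divides z^(m + e_al) but not z^m, so z^k df has no coefficient at m and the
   derivative of z^k supplies the whole term. *)
have kal : k al = (m al).+1.
  apply/eqP; rewrite eqn_leq; apply/andP; split.
    by have /mi_leP/(_ al) := km1; rewrite !ffunE eqxx; lia.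
  rewrite ltnNge; apply: contra km => hk; apply/mi_leP => i.
  have /mi_leP/(_ i) := km1; rewrite !ffunE; case: eqP => [->|]; lia.
have h : mi_le (mi_sub k (mi_e al)) m.
  by apply/mi_leP => i; have /mi_leP/(_ i) := km1; rewrite !ffunE; lia.
rewrite kal /= h; congr (f _ *+ _).
apply/ffunP => i; rewrite !ffunE; have /mi_leP/(_ i) := km1; rewrite !ffunE.
by case: eqP => [->|]; lia.
Qed.

Fact ps_deriv_is_linear W al : linear (@ps_deriv D W al : ps D W -> ps D W).
Proof.
by move=> c f g; apply/funext => m; rewrite /ps_deriv !fctE mulrnDl scalerMnr.
Qed.
HB.instance Definition _ W al := GRing.isLinear.Build K (ps D W) (ps D W) *:%R
  (@ps_deriv D W al) (@ps_deriv_is_linear W al).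

Lemma ps_deriv_z2 W al (f : ps D W) :
  ps_deriv al (ps_z2 f) = ps_z2 (ps_deriv al f) + ps_shift (mi_e al) f *+ 2.
Proof.
rewrite !ps_z2E linear_sum (eq_bigr _ (fun a _ => ps_deriv_shift al (mi_scale 2 (mi_e a)) f)).
rewrite big_split; congr (_ + _); rewrite (bigD1 al) //= big1 ?addr0 => [|i ia].
  rewrite !ffunE eqxx /=; congr (ps_shift _ f *+ 2).
  by apply/ffunP => i; rewrite !ffunE; lia.
by rewrite !ffunE eq_sym (negPf ia).
Qed.

(** The quotient rule for (z^2)^{-N}, cleared of denominators. The extra factor z^2 replaces the
    exponent N - 1 by N, matching [loc_deriv]. *)
Lemma ps_deriv_iter_z2 W al N (f : ps D W) :
  ps_z2 (ps_deriv al (iter N (@ps_z2 D W) f)) =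
  iter N.+1 (@ps_z2 D W) (ps_deriv al f) + ps_shift (mi_e al) (iter N (@ps_z2 D W) f) *+ (2 * N).
Proof.
elim: N => [|N IHN]; first by rewrite muln0 addr0.
rewrite iterS ps_deriv_z2 linearD IHN linearD -addrA; congr (_ + _).
by rewrite !linearMn /= !ps_z2_shift -mulrnDr; congr (_ *+ _); lia.
Qed.

End PowerSeries.

(** * z^2 is a nonzerodivisor when D > 0 *)

Section Torsion.
Variables (K : fieldType) (d : nat).
Implicit Types W : lmodType K.
Local Notation D := d.+1.

(* Read off the coefficient of z^(m + 2 e_0): the other terms have smaller degree
   in the variables different from z^0. *)
Lemma ps_z2_eq0 W (f : ps D W) : ps_z2 f = 0 -> f = 0.
Proof.
move=> f0; apply/funext => m.
move: {2}(\sum_(i | i != ord0) m i)%N (leqnn (\sum_(i | i != ord0) m i)%N) => n.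
elim/ltn_ind: n m => n IHn m hm.
pose m' := mi_add m (mi_scale 2 (mi_e ord0)).
have := congr1 (fun g => g m') f0; rewrite /ps_z2 (bigD1 ord0) //= big1 ?addr0.
  have le_m' : mi_le (mi_scale 2 (mi_e ord0)) m'.
    by apply/mi_leP => i; rewrite !ffunE leq_addl.
  by rewrite /ps_shift le_m' /m' mi_addC mi_addKC.
move=> a a0; rewrite /ps_shift; case: ifP => // /mi_leP h.
have ha : (2 <= m a)%N by have := h a; rewrite !ffunE eqxx (negPf a0); lia.
have hlt : (\sum_(i | i != ord0) mi_sub m' (mi_scale 2 (mi_e a)) i < n)%N.
  apply: leq_trans hm; rewrite (bigD1 a) //= [X in (_ < X)%N](bigD1 a) //=.
  rewrite -addSn leq_add //; first by rewrite !ffunE eqxx (negPf a0); lia.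
  apply: leq_sum => i /andP[i0 ia]; rewrite !ffunE (negPf i0) (negPf ia); lia.
exact: IHn hlt _ (leqnn _).
Qed.

Lemma iter_z2_inj W N : injective (iter N (@ps_z2 D W)).
Proof.
elim: N => [|N IHN] // f g /= h; apply: IHN; apply/eqP; rewrite -subr_eq0; apply/eqP.
by apply: ps_z2_eq0; rewrite linearB; apply/eqP; rewrite subr_eq0; apply/eqP.
Qed.

End Torsion.

Local Open Scope quotient_scope.

(** * The module V[[z]]_{z^2} *)

Section Localization.
Variables (K : fieldType) (d : nat).
Local Notation D := d.+1.

Section Quotient.
Variable W : lmodType K.
Local Notation z2 := (@ps_z2 D W).
Local Notation loc := (loc D W).

Lemma iter_z2C M N (f : ps D W) : iter M z2 (iter N z2 f) = iter N z2 (iter M z2 f).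
Proof. by rewrite -!iterD addnC. Qed.

Lemma loc_eqE (x y : loc) : loc_eq x y <-> iter y.1 z2 x.2 = iter x.1 z2 y.2.
Proof. by split=> [h | h m]; [apply/funext | rewrite h]. Qed.

Definition loc_eqb (x y : loc) : bool := `[< loc_eq x y >].

Fact loc_eqb_refl : reflexive loc_eqb.
Proof. by move=> x; apply/asboolP. Qed.

Fact loc_eqb_sym : symmetric loc_eqb.
Proof. by move=> x y; apply/asboolP/asboolP => h m; rewrite h. Qed.

Fact loc_eqb_trans : transitive loc_eqb.
Proof.
move=> y x z /asboolP/loc_eqE xy /asboolP/loc_eqE yz; apply/asboolP/loc_eqE.
(* The middle denominator is cancelled, which is where injectivity of z^2 enters. *)
apply: (@iter_z2_inj K d W y.1); rewrite iter_z2C xy iter_z2C yz.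
by rewrite iter_z2C.
Qed.

Canonical loc_equiv := EquivRel loc_eqb loc_eqb_refl loc_eqb_sym loc_eqb_trans.

(* Iterated series are then elements of [Loc (Loc W)], see [itq] below. *)
Definition Loc := {eq_quot loc_eqb}.
HB.instance Definition _ : EqQuotient _ loc_eqb Loc := EqQuotient.on Loc.
HB.instance Definition _ := Choice.on Loc.

Definition locq (x : loc) : Loc := \pi_Loc x.
Definition frac N (f : ps D W) : Loc := locq (N, f).

Lemma locqE (x y : loc) : loc_eq x y <-> locq x = locq y.
Proof.
split=> [h | /eqmodP/asboolP //].
by apply/eqmodP/asboolP.
Qed.

Lemma frac_eq N f M g : iter M z2 f = iter N z2 g <-> frac N f = frac M g.
Proof. by split=> [h | /locqE/loc_eqE //]; apply/locqE/loc_eqE. Qed.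

Lemma LocP (x : Loc) : exists N f, x = frac N f.
Proof.
exists (repr x).1, (repr x).2; rewrite /frac -surjective_pairing.
by rewrite /locq reprK.
Qed.

Lemma frac_repr (x : Loc) : frac (repr x).1 (repr x).2 = x.
Proof. by rewrite /frac -surjective_pairing /locq reprK. Qed.

Lemma frac_raise k N f : frac (N + k) (iter k z2 f) = frac N f.
Proof. by apply/frac_eq; rewrite -iterD. Qed.

Definition Loc_add (x y : Loc) := locq (loc_add (repr x) (repr y)).
Definition Loc_zero : Loc := frac 0 0.
Definition Loc_opp (x : Loc) := frac (repr x).1 (- (repr x).2).
Definition Loc_scale (c : K) (x : Loc) := frac (repr x).1 (c *: (repr x).2).

(** Independence of the representatives: the operations are defined through [repr], and all
    computations go through formulas like this one on arbitrary fractions. *)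
Lemma Loc_addE N f M g :
  Loc_add (frac N f) (frac M g) = frac (N + M) (iter M z2 f + iter N z2 g).
Proof.
have /frac_eq := frac_repr (frac N f); have /frac_eq := frac_repr (frac M g).
rewrite /Loc_add; move: (repr _) => [M' g'] /= hg; move: (repr _) => [N' f'] /= hf.
apply/frac_eq => /=; rewrite !linearD /= -!iterD; congr (_ + _).
  by rewrite (_ : N + M + M' = M + M' + N)%N ?iterD ?hf -?iterD; [congr (iter _ _ _)|]; lia.
by rewrite (_ : N + M + N' = N + N' + M)%N ?iterD ?hg -?iterD; [congr (iter _ _ _)|]; lia.
Qed.

Lemma Loc_scaleE c N f : Loc_scale c (frac N f) = frac N (c *: f).
Proof.
have /frac_eq := frac_repr (frac N f); rewrite /Loc_scale.
by move: (repr _) => [N' f'] /= hf; apply/frac_eq; rewrite !linearZ /= hf.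
Qed.

Lemma Loc_oppE N f : Loc_opp (frac N f) = frac N (- f).
Proof.
have /frac_eq := frac_repr (frac N f); rewrite /Loc_opp.
by move: (repr _) => [N' f'] /= hf; apply/frac_eq; rewrite !linearN /= hf.
Qed.

Fact Loc_addA : associative Loc_add.
Proof.
move=> x y z; have [L [f ->]] := LocP x; have [M [g ->]] := LocP y.
have [N [h ->]] := LocP z; rewrite !Loc_addE addnA; congr (frac _ _).
by rewrite !linearD /= -!iterD addrA [(N + M)%N]addnC [(L + N)%N]addnC.
Qed.

Fact Loc_addC : commutative Loc_add.
Proof.
move=> x y; have [L [f ->]] := LocP x; have [M [g ->]] := LocP y.
by rewrite !Loc_addE addnC addrC.
Qed.

Fact Loc_add0 : left_id Loc_zero Loc_add.
Proof.
move=> x; have [L [f ->]] := LocP x.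
by rewrite Loc_addE linear0 add0r.
Qed.

Fact Loc_addN : left_inverse Loc_zero Loc_opp Loc_add.
Proof.
move=> x; have [L [f ->]] := LocP x.
by rewrite Loc_oppE Loc_addE linearN addNr; apply/frac_eq; rewrite !linear0.
Qed.

HB.instance Definition _ := GRing.isZmodule.Build Loc Loc_addA Loc_addC Loc_add0 Loc_addN.

Lemma fracD' N f M g : frac N f + frac M g = frac (N + M) (iter M z2 f + iter N z2 g).
Proof. exact: Loc_addE. Qed.

Lemma fracD N f g : frac N (f + g) = frac N f + frac N g.
Proof. by rewrite fracD' -linearD frac_raise. Qed.

Fact Loc_scaleA a b v : Loc_scale a (Loc_scale b v) = Loc_scale (a * b) v.
Proof. by have [L [f ->]] := LocP v; rewrite !Loc_scaleE scalerA. Qed.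

Fact Loc_scale1 : left_id 1 Loc_scale.
Proof. by move=> v; have [L [f ->]] := LocP v; rewrite !Loc_scaleE scale1r. Qed.

Fact Loc_scaleDr : right_distributive Loc_scale +%R.
Proof.
move=> c x y; have [L [f ->]] := LocP x; have [M [g ->]] := LocP y.
by rewrite fracD' !Loc_scaleE fracD' scalerDr !linearZ.
Qed.

Fact Loc_scaleDl v : {morph Loc_scale^~ v : a b / a + b}.
Proof. by move=> a b; have [L [f ->]] := LocP v; rewrite !Loc_scaleE scalerDl fracD. Qed.

HB.instance Definition _ :=
  GRing.Zmodule_isLmodule.Build K Loc Loc_scaleA Loc_scale1 Loc_scaleDr Loc_scaleDl.

Fact frac_is_linear N : linear (frac N).
Proof. by move=> c f g; rewrite fracD -[c *: frac N f]/(Loc_scale _ _) Loc_scaleE. Qed.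
HB.instance Definition _ N :=
  GRing.isLinear.Build K (ps D W) Loc *:%R (frac N) (frac_is_linear N).

Lemma frac_inj N : injective (frac N).
Proof. by move=> f g /frac_eq /iter_z2_inj. Qed.

Lemma locqD x y : locq (loc_add x y) = locq x + locq y.
Proof. by case: x y => [N f] [M g]; rewrite [RHS]fracD'. Qed.

Lemma locq0 : locq (@loc0 D W) = 0.
Proof. by []. Qed.

Lemma locq_sum (I : Type) (r : seq I) (Q : pred I) F :
  locq (\big[@loc_add D W/@loc0 D W]_(i <- r | Q i) F i) = \sum_(i <- r | Q i) locq (F i).
Proof. exact: (big_morph locq locqD locq0). Qed.

End Quotient.

Section Functoriality.
Variables W W' : lmodType K.

(** Acts on a chosen numerator; when A is linear and commutes with z^2, as in [liftE], it is the
    extension of A to the localization. *)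
Definition lift (A : ps D W -> ps D W') (x : Loc W) : Loc W' :=
  frac (repr x).1 (A (repr x).2).

Lemma liftE (A : {linear ps D W -> ps D W'}) N f :
  (forall f, A (ps_z2 f) = ps_z2 (A f)) -> lift A (frac N f) = frac N (A f).
Proof.
move=> hA; have /frac_eq := frac_repr (frac N f); rewrite /lift.
move: (repr _) => [N' f'] /= hf; apply/frac_eq.
by rewrite -!(iter_comm _ hA) hf.
Qed.

Lemma lift_linear (A : {linear ps D W -> ps D W'}) :
  (forall f, A (ps_z2 f) = ps_z2 (A f)) -> linear (lift A).
Proof.
move=> hA c x y; have [L [f ->]] := LocP x; have [M [g ->]] := LocP y.
rewrite -linearZ fracD' !liftE // -linearZ fracD'; congr frac.
by rewrite linearD !(iter_comm _ hA) linearZ.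
Qed.

(** With F = Y(a,z) acting on the coefficients of Y(b,w)c, this produces Y(a,z)Y(b,w)c as an
    iterated series, z inner and w outer. *)
Definition lmap (F : {linear W -> W'}) := lift (ps_map F).

Lemma lmapE F N f : lmap F (frac N f) = frac N (ps_map F f).
Proof. exact/liftE/ps_map_z2. Qed.

HB.instance Definition _ (F : {linear W -> W'}) :=
  GRing.isLinear.Build K (Loc W) (Loc W') *:%R (lmap F)
    (lift_linear (@ps_map_z2 K D W W' F)).

Lemma locq_map (F : {linear W -> W'}) (x : loc D W) :
  locq (x.1, fun m => F (x.2 m)) = lmap F (locq x).
Proof. by case: x => N f; rewrite [RHS]lmapE. Qed.

End Functoriality.

Section Shift.
Variable W : lmodType K.
Implicit Types (x : Loc W) (k l : mi D).

Definition lsh k := lift (@ps_shift D W k).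

Lemma lshE k N f : lsh k (frac N f) = frac N (ps_shift k f).
Proof. by apply: liftE => g; rewrite ps_z2_shift. Qed.

Fact lsh_is_linear k : linear (lsh k).
Proof. by apply: lift_linear => g; rewrite ps_z2_shift. Qed.
HB.instance Definition _ k :=
  GRing.isLinear.Build K (Loc W) (Loc W) *:%R (lsh k) (lsh_is_linear k).

Lemma locq_shift k (x : loc D W) : locq (loc_shift k x) = lsh k (locq x).
Proof. by case: x => N f; rewrite [RHS]lshE. Qed.

Lemma lshC k l x : lsh k (lsh l x) = lsh l (lsh k x).
Proof. by have [N [f ->]] := LocP x; rewrite !lshE ps_shiftC. Qed.

End Shift.

Section Naturality.
Variable W : lmodType K.
Implicit Types (x : Loc W) (k l : mi D).

Lemma lmap_lsh (W' : lmodType K) (F : {linear W -> W'}) k x :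
  lmap F (lsh k x) = lsh k (lmap F x).
Proof. by have [N [f ->]] := LocP x; rewrite !(lshE, lmapE) ps_map_shift. Qed.

Lemma lmap_comp (W' W'' : lmodType K) (F : {linear W -> W'}) (G : {linear W' -> W''})
  (H : {linear W -> W''}) x : (forall w, G (F w) = H w) -> lmap G (lmap F x) = lmap H x.
Proof.
move=> h; have [N [f ->]] := LocP x; rewrite !lmapE; congr frac.
by apply/funext => m; apply: h.
Qed.

Lemma eq_lmap (W' : lmodType K) (F G : {linear W -> W'}) x :
  F =1 G -> lmap F x = lmap G x.
Proof.
move=> h; have [N [f ->]] := LocP x; rewrite !lmapE; congr frac.
by apply/funext => m; apply: h.
Qed.

End Naturality.
End Localization.

(** * Iterated series and mutual locality *)

Section IteratedSeries.
Variables (K : fieldType) (d : nat) (W : lmodType K).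
Local Notation D := d.+1.
Local Notation LW := (Loc d W).
Local Notation LLW := (Loc d LW).
Implicit Types (x y : LLW) (k : mi D).
Local Notation e2 a := (mi_scale 2 (mi_e a)).

Definition itq (x : iser D W) : LLW := frac x.1 (fun p => locq (x.2 p)).

Lemma locq_it_z2 (h : mi D -> loc D W) :
  (fun p => locq (it_z2 h p)) = ps_z2 (fun p => locq (h p)).
Proof.
apply/funext => p; rewrite /it_z2 locq_sum; apply: eq_bigr => a _.
by rewrite /ps_shift; case: ifP.
Qed.

Lemma locq_iter_it_z2 N (h : mi D -> loc D W) :
  (fun p => locq (iter N (@it_z2 D W) h p)) = iter N (@ps_z2 D LW) (fun p => locq (h p)).
Proof. by elim: N => //= N <-; rewrite locq_it_z2. Qed.

Lemma itqE (x y : iser D W) : it_eq x y <-> itq x = itq y.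
Proof.
rewrite /itq; split=> [h | /frac_eq h p].
  apply/frac_eq; rewrite -!locq_iter_it_z2; apply/funext => p.
  exact/locqE.
by apply/locqE; have := congr1 (fun g => g p) h; rewrite -!locq_iter_it_z2.
Qed.

Lemma itqD (x y : iser D W) : itq (it_add x y) = itq x + itq y.
Proof.
rewrite /itq fracD' -!locq_iter_it_z2; congr frac.
by apply/funext => p; rewrite locqD.
Qed.

Lemma itq0 : itq (@it0 D W) = 0.
Proof. by []. Qed.

Lemma itq_sum (I : Type) (r : seq I) (Q : pred I) F :
  itq (\big[@it_add D W/@it0 D W]_(i <- r | Q i) F i) = \sum_(i <- r | Q i) itq (F i).
Proof. exact: (big_morph itq itqD itq0). Qed.

(** Multiplication by (z-w)^2 on classes: [lmap] of [lsh] multiplies by the inner variable, [lsh]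
    itself by the outer one. *)
Definition cross (x : LLW) : LLW :=
  \sum_(a : 'I_D) (lmap (@lsh K d W (e2 a)) x
    - lmap (@lsh K d W (mi_e a)) (lsh (mi_e a) x) *+ 2 + lsh (e2 a) x).

Fact cross_is_linear : linear cross.
Proof.
move=> c x y; rewrite scaler_sumr -big_split; apply: eq_bigr => a _.
rewrite !linearP /= mulrnDl opprD !scalerDr scalerN scalerMnr.
by rewrite [X in X + _ = _]addrACA [LHS]addrACA.
Qed.
HB.instance Definition _ := GRing.isLinear.Build K LLW LLW *:%R cross cross_is_linear.

Definition ps_cross (h : ps D LW) : ps D LW :=
  \sum_(a : 'I_D) (ps_map (@lsh K d W (e2 a)) h
    - ps_map (@lsh K d W (mi_e a)) (ps_shift (mi_e a) h) *+ 2 + ps_shift (e2 a) h).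

Lemma cross_frac N h : cross (frac N h) = frac N (ps_cross h).
Proof.
rewrite /cross /ps_cross linear_sum; apply: eq_bigr => a _.
by rewrite !(lshE, lmapE) [RHS]linearD [X in _ = X + _]linearB [X in _ = _ - X + _]linearMn.
Qed.

Lemma locq_neg2 (x : loc D W) :
  locq (loc_map (fun v => - (v *+ 2)) x) = - (locq x *+ 2).
Proof.
case: x => N f; rewrite -[locq (N, f)]/(frac N f) -linearMn -linearN.
by congr frac; apply/funext => m; rewrite fctE fct_Mn.
Qed.

Lemma itq_cross (x : iser D W) : itq (x.1, it_cross x.2) = cross (itq x).
Proof.
rewrite cross_frac; congr frac; apply/funext => p /=.
rewrite /it_cross locq_sum /ps_cross fct_sumE; apply: eq_bigr => a _.
rewrite !fctE !locqD locq_shift /ps_map; congr (_ + _ + _).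
  rewrite fct_Mn /ps_shift; case: ifP => _; last by rewrite linear0 mul0rn oppr0.
  by rewrite locq_neg2 locq_shift.
by rewrite /ps_shift; case: ifP.
Qed.

Lemma itq_crossN N (x : iser D W) : itq (it_crossN N x) = iter N cross (itq x).
Proof.
by elim: N => [|N IHN]; [case: x | rewrite iterS -IHN -itq_cross].
Qed.

(* The coefficient of w^p in (z - w)^2 h is z^2 h_p plus terms in h_q with |q| < |p|. *)
Lemma ps_cross_eq0 h : ps_cross h = 0 -> h = 0.
Proof.
move=> h0; apply/funext => p.
move: {2}(mi_deg p) (leqnn (mi_deg p)) => n.
elim/ltn_ind: n p => n IHn p hp.
have low k : (0 < mi_deg k)%N -> ps_shift k h p = 0.
  move=> k0; rewrite /ps_shift; case: ifP => // kp.
  have := mi_le_deg kp => hkp.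
  by apply: (IHn (mi_deg (mi_sub p k))) => //; rewrite mi_deg_sub //; lia.
have := congr1 (fun g => g p) h0; rewrite /ps_cross fct_sumE.
rewrite (eq_bigr (fun a => lsh (e2 a) (h p))) => [|a _]; last first.
  rewrite !fctE fct_Mn /ps_map !low ?mi_deg_scale ?mi_deg_e //.
  by rewrite linear0 mul0rn oppr0 !addr0.
have [N [f ->]] := LocP (h p).
rewrite (eq_bigr (fun a => frac N (ps_shift (e2 a) f))) => [|a _]; last by rewrite lshE.
rewrite -linear_sum -ps_z2E -[RHS](linear0 (frac N)) => /frac_inj /ps_z2_eq0 ->.
by rewrite linear0.
Qed.

(** Cancellation of (z-w)^2 is special to iterated series with bounded denominators: among doubly
    infinite distributions it fails, since for D = 1 the factor z - w kills the delta function. *)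
Lemma iter_cross_inj N : injective (iter N cross).
Proof.
elim: N => [|N IHN] // x y /= h; apply: IHN; apply/eqP; rewrite -subr_eq0; apply/eqP.
move: h => /eqP; rewrite -subr_eq0 -linearB /= => /eqP.
have [M [f ->]] := LocP (iter N cross x - iter N cross y).
by rewrite cross_frac -[RHS](linear0 (frac M)) => /frac_inj /ps_cross_eq0 ->; rewrite linear0.
Qed.

Lemma cross_lsh k x : cross (lsh k x) = lsh k (cross x).
Proof.
rewrite /cross linear_sum; apply: eq_bigr => a _.
rewrite !(lshC _ k) !lmap_lsh.
by rewrite [RHS]linearD [X in _ = X + _]linearB [X in _ = _ - X + _]linearMn.
Qed.

Lemma lmap_lshC k l x : lmap (@lsh K d W k) (lmap (@lsh K d W l) x) =
  lmap (@lsh K d W l) (lmap (@lsh K d W k) x).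
Proof.
have [N [f ->]] := LocP x; rewrite !lmapE; congr frac.
by apply/funext => m; apply: lshC.
Qed.

Lemma cross_lmap_lsh k x : cross (lmap (@lsh K d W k) x) = lmap (@lsh K d W k) (cross x).
Proof.
rewrite /cross linear_sum; apply: eq_bigr => a _.
rewrite -lmap_lsh !(lmap_lshC _ k) -lmap_lsh.
by rewrite [RHS]linearD [X in _ = X + _]linearB [X in _ = _ - X + _]linearMn.
Qed.

Definition emb L (G : ps D (ps D W)) : LLW :=
  frac L (fun p => frac L (fun m => G m p)).

Lemma itq_emb_w L (G : ps2 D W) : itq (emb_w L G) = emb L G.
Proof. by []. Qed.

Lemma itq_emb_z L (G : ps2 D W) : itq (emb_z L G) = emb L (ps2_swap G).
Proof. by []. Qed.

Local Notation z2w2 := (@ps2_z2w2 D W).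

Lemma ps2_swap_z2 (G : ps D (ps D W)) :
  ps2_swap (ps_z2 G) = ps_map (@ps_z2 D W) (ps2_swap G).
Proof.
apply/funext => p; apply/funext => m.
rewrite /ps_map /ps2_swap /ps_z2 fct_sumE; apply: eq_bigr => a _.
by rewrite /ps_shift; case: ifP.
Qed.

Lemma z2w2E (G : ps D (ps D W)) : z2w2 G = ps_z2 (ps_map (@ps_z2 D W) G).
Proof.
apply/funext => m; apply/funext => p.
rewrite /ps2_z2w2 -[RHS]/(ps2_swap _ p m) ps2_swap_z2 //.
Qed.

Lemma swap_z2w2 (G : ps D (ps D W)) : ps2_swap (z2w2 G) = z2w2 (ps2_swap G).
Proof.
have swap_map H : ps2_swap (ps_map (@ps_z2 D W) H) = ps_z2 (ps2_swap H).
  exact: (congr1 (@ps2_swap D W) (esym (ps2_swap_z2 (ps2_swap H)))).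
by rewrite !z2w2E ps2_swap_z2 swap_map ps_map_z2.
Qed.

Lemma iter_z2w2E N (G : ps D (ps D W)) :
  iter N z2w2 G = ps_map (iter N (@ps_z2 D W)) (iter N (@ps_z2 D (ps D W)) G).
Proof.
elim: N => [|N IHN] //=; rewrite IHN z2w2E -ps_map_z2.
by congr (ps_map _ _); rewrite -ps_map_z2.
Qed.

Fact z2w2_is_linear : linear (z2w2 : ps D (ps D W) -> ps D (ps D W)).
Proof. by move=> c G H; rewrite !z2w2E !linearP. Qed.
HB.instance Definition _ :=
  GRing.isLinear.Build K (ps D (ps D W)) (ps D (ps D W)) *:%R z2w2 z2w2_is_linear.

(** Clearing the outer denominator commutes with taking inner fractions, so equality can be tested
    coefficientwise in the outer variable. In particular no information is lost in the iterated
    expansion. *)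
Lemma emb_eq L G L' G' :
  emb L G = emb L' G' <-> iter L' z2w2 G = iter L z2w2 G'.
Proof.
have embE M H : emb M H = frac M (ps_map (@frac K d W M) (ps2_swap H)) by [].
have aux M M' H : iter M' (@ps_z2 D LW) (ps_map (@frac K d W M) (ps2_swap H))
    = ps_map (frac M) (iter M' (@ps_z2 D (ps D W)) (ps2_swap H)).
  by rewrite (iter_comm M' (ps_map_z2 (@frac K d W M))).
rewrite !embE; split.
  move=> /frac_eq; rewrite !aux => h.
  suff: ps2_swap (iter L' z2w2 G) = ps2_swap (iter L z2w2 G').
    exact: (congr1 (@ps2_swap D W)).
  rewrite !(iter_comm _ swap_z2w2) !iter_z2w2E; apply/funext => p.
  by apply/frac_eq; have := congr1 (fun g => g p) h.
move=> h; apply/frac_eq; rewrite !aux; apply/funext => p; apply/frac_eq.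
move/(congr1 (@ps2_swap D W)): h; rewrite !(iter_comm _ swap_z2w2) !iter_z2w2E.
exact: (congr1 (fun g => g p)).
Qed.

Lemma emb_raise n L G : emb (L + n) (iter n z2w2 G) = emb L G.
Proof. by apply/emb_eq; rewrite -iterD. Qed.

Fact emb_is_linear L : linear (emb L).
Proof.
move=> c G H; have embE J : emb L J = frac L (ps_map (@frac K d W L) (ps2_swap J)) by [].
rewrite !embE (_ : ps2_swap _ = c *: (ps2_swap G : ps D (ps D W)) + ps2_swap H) //.
by rewrite !linearP.
Qed.
HB.instance Definition _ L :=
  GRing.isLinear.Build K (ps D (ps D W)) LLW *:%R (emb L) (emb_is_linear L).

(* [x] and [y] are the expansions in V[[z]]_{z^2}[[w]]_{w^2} and V[[w]]_{w^2}[[z]]_{z^2}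
   of the same element of V[[z,w]]_{z^2 w^2}. *)
Definition same_series x y := exists L G, x = emb L G /\ y = emb L (ps2_swap G).

(** A two-variable fraction is determined by either of its expansions. In Goddard's argument, y is
    the product in the opposite order, applied to the vacuum. *)
Lemma same_series_inj x x' y : same_series x y -> same_series x' y -> x = x'.
Proof.
move=> [L [G [-> ->]]] [L' [G' [-> /emb_eq h]]]; apply/emb_eq.
by move/(congr1 (@ps2_swap D W)): h; rewrite !(iter_comm _ swap_z2w2).
Qed.

Lemma same_series_sym x y : same_series x y -> same_series y x.
Proof. by move=> [L [G [-> ->]]]; exists L, (ps2_swap G). Qed.

Lemma same_seriesD x y x' y' :
  same_series x y -> same_series x' y' -> same_series (x + x') (y + y').
Proof.
move=> [L [G [-> ->]]] [L' [G' [-> ->]]].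
exists (L + L')%N, ((iter L' z2w2 G : ps D (ps D W)) + iter L z2w2 G'); split.
  by rewrite linearD /= emb_raise addnC emb_raise.
have -> : ps2_swap ((iter L' z2w2 G : ps D (ps D W)) + iter L z2w2 G') =
  (ps2_swap (iter L' z2w2 G) : ps D (ps D W)) + ps2_swap (iter L z2w2 G') by [].
by rewrite !(iter_comm _ swap_z2w2) linearD /= emb_raise addnC emb_raise.
Qed.

Lemma same_seriesZ c x y : same_series x y -> same_series (c *: x) (c *: y).
Proof.
move=> [L [G [-> ->]]]; exists L, (c *: (G : ps D (ps D W))).
by rewrite -!linearZ.
Qed.

Lemma same_series0 : same_series 0 0.
Proof. by exists 0%N, 0; rewrite -[ps2_swap 0]/(0 : ps D (ps D W)) !linear0. Qed.

Lemma same_series_sum (I : Type) (r : seq I) (Q : pred I) (F F' : I -> LLW) :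
  (forall i, Q i -> same_series (F i) (F' i)) ->
  same_series (\sum_(i <- r | Q i) F i) (\sum_(i <- r | Q i) F' i).
Proof.
move=> h; elim/big_ind2: _ => //; first exact: same_series0.
by move=> *; apply: same_seriesD.
Qed.

(** Multiplication by z^k: z is inner in the first expansion and outer in the second. *)
Lemma same_series_in k x y :
  same_series x y -> same_series (lmap (@lsh K d W k) x) (lsh k y).
Proof.
move=> [L [G [-> ->]]]; exists L, (ps_shift k (G : ps D (ps D W))); split.
  rewrite lmapE; congr frac; apply/funext => p; rewrite /ps_map /= lshE; congr frac.
  by apply/funext => m; rewrite /ps_shift; case: ifP.
rewrite lshE; congr frac; apply/funext => p.
rewrite /ps2_swap /ps_shift; case: ifP => // _.
exact: esym (linear0 (@frac K d W L)).
Qed.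

Lemma same_series_out k x y :
  same_series x y -> same_series (lsh k x) (lmap (@lsh K d W k) y).
Proof. by move=> /same_series_sym h; apply/same_series_sym/same_series_in. Qed.

Lemma same_series_cross N x y :
  same_series x y -> same_series (iter N cross x) (iter N cross y).
Proof.
move=> h; elim: N => //= N IHN; apply: same_series_sum => a _.
(* (z-w)^2 is symmetric: exchanging the variables swaps its two squares, so these summands trade
   places. *)
rewrite [X in same_series _ X]addrC [X in same_series _ X]addrCA [X in same_series _ X]addrC.
rewrite -!scaler_nat -!scaleNr; apply: same_seriesD; last exact: same_series_out.
apply: same_seriesD; first exact: same_series_in.
by apply/same_seriesZ; rewrite lmap_lsh; apply/same_series_out/same_series_in.
Qed.

(** The index c stands for the vector acted on; the exponent N is uniform in it. *)
Definition mutually_local (I : Type) (x y : I -> LLW) :=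
  exists N, forall c, same_series (iter N cross (x c)) (iter N cross (y c)).

Section MutualLocality.
Variable I : Type.
Implicit Types f g : I -> LLW.

Lemma mlocalD f g f' g' : mutually_local f g -> mutually_local f' g' ->
  mutually_local (fun c => f c + f' c) (fun c => g c + g' c).
Proof.
move=> [N h] [N' h']; exists (N + N')%N => c; rewrite !linearD /=; apply: same_seriesD.
  by rewrite addnC !iterD; apply: same_series_cross.
by rewrite !iterD; apply: same_series_cross.
Qed.

Lemma mlocal_sum (J : Type) (r : seq J) (Q : pred J) (F F' : J -> I -> LLW) :
  (forall j, Q j -> mutually_local (F j) (F' j)) ->
  mutually_local (fun c => \sum_(j <- r | Q j) F j c) (fun c => \sum_(j <- r | Q j) F' j c).
Proof.
move=> h; elim: r => [|j r IHr].
  by exists 0%N => c; rewrite !big_nil; apply: same_series0.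
have [Qj|Qj] := boolP (Q j); last first.
  have [N hN] := IHr; exists N => c; rewrite !big_cons (negPf Qj); exact: hN.
have [N hN] := mlocalD (h j Qj) IHr; exists N => c; rewrite !big_cons Qj; exact: hN.
Qed.

Lemma mlocal_shift k f g : mutually_local f g ->
  mutually_local (fun c => lmap (@lsh K d W k) (f c)) (fun c => lsh k (g c)).
Proof.
move=> [N h]; exists N => c.
rewrite -(iter_comm N (fun x => esym (cross_lsh k x))).
rewrite -(iter_comm N (fun x => esym (cross_lmap_lsh k x))).
exact: same_series_in.
Qed.

End MutualLocality.
End IteratedSeries.

(** * Finite sums over boxes of multi-indices *)

Lemma big_support (I : eqType) (M : nmodType) (r s : seq I) (F : I -> M) :
  uniq r -> uniq s ->
  (forall i, F i != 0 -> (i \in r) && (i \in s)) ->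
  \sum_(i <- r) F i = \sum_(i <- s) F i.
Proof.
move=> ur us h; have nz t : \sum_(i <- t) F i = \sum_(i <- [seq i <- t | F i != 0]) F i.
  rewrite big_filter [RHS]big_mkcond; apply: eq_bigr => i _.
  by case: eqP => [->|].
rewrite nz [RHS]nz; apply/perm_big/uniq_perm; rewrite ?filter_uniq // => i.
by rewrite !mem_filter; case: (boolP (F i != 0)) => //= /h /andP[-> ->].
Qed.

Lemma lmod_mulrSI (K : numFieldType) (V : lmodType K) n : injective (fun v : V => v *+ n.+1).
Proof. by move=> v w /=; rewrite -!scaler_nat; apply/scalerI; rewrite pnatr_eq0. Qed.

Section Box.
Variable D : nat.

(** The summation range of [Ypoly]. It contains all multi-indices of degree at most n, so a
    polynomial vanishing in degrees above n is summed completely. *)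
Definition box n : seq (mi D) := [seq mk_mi k | k : {ffun 'I_D -> 'I_n.+1}].

Lemma mem_box n m : (m \in box n) = [forall i, m i <= n]%N.
Proof.
apply/imageP/forallP => [[k _ ->] i | h]; first by rewrite ffunE -ltnS.
exists [ffun i => inord (m i)] => //; apply/ffunP => i.
by rewrite !ffunE inordK // ltnS.
Qed.

Lemma box_uniq n : uniq (box n).
Proof.
rewrite map_inj_uniq ?enum_uniq // => k l /ffunP h; apply/ffunP => i; apply: val_inj.
by have := h i; rewrite !ffunE.
Qed.

Lemma deg_box n m : (mi_deg m <= n)%N -> m \in box n.
Proof.
by move=> h; rewrite mem_box; apply/forallP => i; apply: leq_trans (leq_mi_deg m i) h.
Qed.

Lemma box_sum (M : nmodType) n (F : mi D -> M) :
  \sum_(k : {ffun 'I_D -> 'I_n.+1}) F (mk_mi k) = \sum_(k <- box n) F k.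
Proof. by rewrite big_image. Qed.

End Box.

(** * The series e^{-ad(z.T)} X *)

Section ExponentialSeries.
Variables (K : numFieldType) (V : lmodType K) (D : nat) (T : 'I_D -> {linear V -> V}).
Hypothesis TC : forall al be v, T al (T be v) = T be (T al v).

Lemma adTC al be F : adT T al (adT T be F) = adT T be (adT T al F).
Proof.
apply/funext => v; rewrite /adT (linearB (T al)) (linearB (T be)) !(TC al be) !opprB.
by rewrite addrACA [RHS]addrACA [- T al _ - _]addrC.
Qed.

(** [ads] composes the ad(T_i) in a fixed order; as they commute, the additional factor can be moved
    to the front. *)
Lemma adsS m al F : ads T (mi_add m (mi_e al)) F = adT T al (ads T m F).
Proof.
have aux s : uniq s ->
    foldr (fun be G => iter (mi_add m (mi_e al) be) (adT T be) G) F s =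
    iter (al \in s) (adT T al) (foldr (fun be G => iter (m be) (adT T be) G) F s).
  elim: s => //= be s IHs /andP[bes us]; rewrite IHs // !ffunE inE.
  case: (eqVneq al be) => [->|_] /=; first by rewrite (negPf bes) addn1.
  by rewrite addn0; case: (al \in s) => //=; rewrite (iter_comm _ (adTC al be)).
by rewrite /ads aux ?enum_uniq // mem_enum.
Qed.

Variable X : {linear V -> V}.

(** The coefficients of the differential equation d_al E = -ad(T_al) E, which together with E(0) = X
    determines E. *)
Lemma expad_rec m al v :
  expad T X (mi_add m (mi_e al)) v *+ (m al).+1 = expad T X m (T al v) - T al (expad T X m v).
Proof.
rewrite /expad adsS /adT linearZ /= -scalerBr -scaler_nat scalerA -[_ - T al _]opprB scalerN -scaleNr.
congr (_ *: _); rewrite mi_degD mi_deg_e addn1 exprS.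
rewrite (bigD1 al) //= [in RHS](bigD1 al) //=.
rewrite (eq_bigr (fun i => (m i)`!)) => [|i ia]; last by rewrite !ffunE (negPf ia) addn0.
rewrite !ffunE eqxx addn1 factS !natrM mulN1r !invfM mulNr mulrN; congr (- _).
by rewrite mulrCA -!mulrA mulVKf ?pnatr_eq0.
Qed.

Lemma expad0 v : expad T X (mi0 D) v = X v.
Proof.
rewrite /expad /ads (_ : mi_deg _ = 0)%N; last by rewrite /mi_deg big1 // => i _; rewrite ffunE.
rewrite big1 => [|i _]; last by rewrite ffunE.
rewrite expr0 divr1 scale1r; congr (_ v).
by elim: (enum _) => //= i s ->; rewrite ffunE.
Qed.

Fact expad_is_linear m : linear (expad T X m).
Proof.
move=> c u v; rewrite /expad scalerA [c * _]mulrC -(scalerA _ c) -scalerDr; congr (_ *: _).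
have adT_linear al F : linear F -> linear (adT T al F).
  move=> hF a x y; rewrite /adT (linearP (T al) a x y) !hF (linearP (T al)) scalerBr opprD.
  by rewrite addrACA.
rewrite /ads; elim: (enum _) c u v => [|i s IHs] /=; first exact: linearP.
by elim: (m i) => // n IHn; apply: adT_linear.
Qed.
HB.instance Definition _ m := GRing.isLinear.Build K V V *:%R (expad T X m) (expad_is_linear m).

(* [y a] stands for [Y(a,z)1 = e^{zT} a]. *)
Variable y : {linear V -> ps D V}.
Hypothesis y0 : forall a, y a (mi0 D) = a.
Hypothesis yT : forall al a, ps_deriv al (y a) = ps_map (T al) (y a).

(** Both sides start at T_al a and solve d_be f = T_be f, since the T's commute; characteristic zero
    makes the solution unique. *)
Lemma y_T al a : y (T al a) = ps_map (T al) (y a).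
Proof.
apply/funext; elim/mi_ind => [|m be IHm]; first by rewrite /ps_map !y0.
apply: (@lmod_mulrSI _ _ (m be)) => /=.
rewrite -[LHS]/(ps_deriv be _ m) yT /ps_map IHm -linearMn.
by rewrite -[y a _ *+ _]/(ps_deriv be _ m) yT /ps_map TC.
Qed.

(** This is e^{z.T} p(z), that is Y(p(z),z)1, for a polynomial p. *)
Definition conv n (p : mi D -> V) : ps D V := \sum_(k <- box D n) ps_shift k (y (p k)).

Definition vanish n (p : mi D -> V) := forall m, (n < mi_deg m)%N -> p m = 0.

Lemma conv_indep n n' p : vanish n p -> vanish n' p -> conv n p = conv n' p.
Proof.
move=> h h'; apply: big_support; rewrite ?box_uniq // => k.
apply: contraR; rewrite negb_and => hk; rewrite (_ : p k = 0) ?linear0 //.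
by case/orP: hk => hk; [apply: h | apply: h']; rewrite ltnNge; apply: contra hk; apply: deg_box.
Qed.

Lemma convB n p q : conv n (fun k => p k - q k) = conv n p - conv n q.
Proof. by rewrite /conv -sumrB; apply: eq_bigr => k _; rewrite !linearB. Qed.

(* The coefficient of z^m is p_m plus terms in the p_k with |k| < |m|. *)
Lemma conv_eq0 n p : vanish n p -> conv n p = 0 -> forall m, p m = 0.
Proof.
move=> hp h m; have [N] := ubnP (mi_deg m); elim: N m => // N IHN m hm.
have := congr1 (fun f => f m) h; rewrite /conv fct_sumE.
rewrite (_ : \sum_(k <- _) _ = \sum_(k <- [:: m]) ps_shift k (y (p k)) m).
  rewrite big_seq1 /ps_shift (_ : mi_le m m); last by apply/mi_leP.
  by rewrite (_ : mi_sub m m = mi0 D) ?y0 //; apply/ffunP => i; rewrite !ffunE subnn.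
apply: big_support; rewrite ?box_uniq // => k hk; rewrite inE.
have km : k == m.
  apply: contraNT hk => km; rewrite /ps_shift; case: ifP => // le_km.
  suff -> : p k = 0 by rewrite linear0.
  rewrite ltnS in hm; apply: IHN; apply: leq_trans hm; rewrite ltn_neqAle mi_le_deg // andbT.
  apply: contra km => /eqP hdeg; have := mi_deg_sub le_km; rewrite hdeg subnn => /mi_deg_eq0 e.
  by rewrite -(mi_subKC le_km) e; apply/eqP/ffunP => i; rewrite !ffunE addn0.
rewrite km andbT; apply: deg_box; rewrite leqNgt; apply: contraNN hk => /hp ->.
by rewrite !linear0.
Qed.

Lemma conv_0 n p : conv n p (mi0 D) = p (mi0 D).
Proof.
rewrite /conv fct_sumE.
rewrite (_ : \sum_(k <- _) _ = \sum_(k <- [:: mi0 D]) ps_shift k (y (p k)) (mi0 D)).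
  by rewrite big_seq1 /ps_shift mi_le0 mi_sub0 y0.
apply: big_support; rewrite ?box_uniq // => k; rewrite /ps_shift inE.
case: ifP => [hk _|]; last by rewrite eqxx.
have -> : k = mi0 D.
  by apply/ffunP => i; have /mi_leP/(_ i) := hk; rewrite !ffunE leqn0 => /eqP.
by rewrite eqxx andbT mem_box; apply/forallP => i; rewrite ffunE.
Qed.

(** The product rule d_al(e^{z.T} p) = e^{z.T}(T_al p + d_al p). *)
Lemma conv_deriv n p al : vanish n p ->
  ps_deriv al (conv n p) =
  conv n (fun k => T al (p k) + p (mi_add k (mi_e al)) *+ (k al).+1).
Proof.
move=> hp; rewrite /conv linear_sum.
rewrite (eq_bigr _ (fun k _ => ps_deriv_shift al k (y (p k)))) big_split.
under [RHS]eq_bigr do rewrite 2!linearD.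
rewrite [RHS]big_split; congr (_ + _).
  by apply: eq_bigr => k _; rewrite yT y_T.
pose G (k : mi D) := if (0 < k al)%N then ps_shift (mi_sub k (mi_e al)) (y (p k)) *+ k al else 0.
have addI : injective (fun k : mi D => mi_add k (mi_e al)).
  by move=> k l /(congr1 (fun m => mi_sub m (mi_e al))); rewrite /= ![mi_add _ (mi_e _)]mi_addC !mi_addKC.
(* Reindexing by k + e_al shifts the box; the degree bound on p keeps every nonzero term inside both
   ranges. *)
transitivity (\sum_(k <- [seq mi_add k (mi_e al) | k <- box D n]) G k).
  apply: big_support; rewrite ?(map_inj_uniq addI) ?box_uniq // => k.
  case: ifP => [hk|]; last by rewrite eqxx.
  move=> nz; have pk : (mi_deg k <= n)%N.
    by rewrite leqNgt; apply: contraNN nz => /hp ->; rewrite !linear0 mul0rn.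
  rewrite deg_box //=; rewrite -mi_e_le in hk; rewrite -(mi_subKC hk) mi_addC.
  apply: (map_f (fun k0 : mi D => mi_add k0 (mi_e al))).
  by apply: deg_box; rewrite mi_deg_sub //; apply: leq_trans (leq_subr _ _) pk.
rewrite big_map; apply: eq_bigr => k _; rewrite /G !ffunE eqxx addn1 /= mi_addC mi_addKC mi_addC.
by rewrite !linearMn.
Qed.

(** Both sides, as families U(z) of operators, satisfy U(0) = X and d_al U(z)a = U(z) T_al a. The
    induction on coefficients keeps a general because differentiation replaces a by T_al a. *)
Lemma conv_expad (n : V -> nat) :
  (forall a, vanish (n a) (expad T X ^~ a)) ->
  forall a, conv (n a) (expad T X ^~ a) = ps_map X (y a).
Proof.
move=> h a; apply/funext => m; elim/mi_ind: m a => [|m al IHm] a.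
  by rewrite conv_0 expad0 /ps_map y0.
apply: (@lmod_mulrSI _ _ (m al)) => /=.
rewrite -[LHS]/(ps_deriv al _ m) conv_deriv // /ps_map -linearMn.
rewrite -[y a _ *+ _]/(ps_deriv al _ m) yT -y_T -[RHS]/(ps_map X _ m) -IHm.
have E k : T al (expad T X k a) + expad T X (mi_add k (mi_e al)) a *+ (k al).+1
    = expad T X k (T al a) by rewrite expad_rec addrC subrK.
rewrite (_ : (fun k => _) = expad T X ^~ (T al a)); last exact/funext.
(* The bound [n a] also serves T_al a: by [E], the coefficient at k for T_al a involves only
   coefficients for a of degree at least that of k. *)
congr (_ m); apply: conv_indep => // k hk; rewrite -E !h ?linear0 ?add0r ?mul0rn //.
by rewrite mi_degD; apply: leq_trans hk _; rewrite leq_addr.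
Qed.

(** Differentiating e^{z.T} X(z)a = X e^{z.T} a and cancelling e^{z.T} shows that X(z) obeys the
    recursion of [expad_rec], with the same initial value X. *)
Lemma conv_expad_unique (Xz : V -> mi D -> V) (n : V -> nat) :
  (forall a, Xz a (mi0 D) = X a) ->
  (forall a, vanish (n a) (Xz a)) ->
  (forall a, conv (n a) (Xz a) = ps_map X (y a)) ->
  forall a m, Xz a m = expad T X m a.
Proof.
move=> Xz0 hn hX.
have Xrec al a m : Xz a (mi_add m (mi_e al)) *+ (m al).+1 = Xz (T al a) m - T al (Xz a m).
  pose q (k : mi D) := T al (Xz a k) + Xz a (mi_add k (mi_e al)) *+ (k al).+1.
  pose N := maxn (n a) (n (T al a)).
  have hq : vanish (n a) q.
    move=> k hk; rewrite /q !hn ?linear0 ?add0r ?mul0rn //.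
    by rewrite mi_degD; apply: leq_trans hk _; rewrite leq_addr.
  have hqN : vanish N q by move=> k hk; apply: hq; apply: leq_ltn_trans hk; apply: leq_maxl.
  have hTN : vanish N (Xz (T al a)).
    by move=> k hk; apply: hn; apply: leq_ltn_trans hk; apply: leq_maxr.
  have /(_ m) : forall k, q k - Xz (T al a) k = 0.
    apply: (@conv_eq0 N) => [k hk|]; first by rewrite hqN // hTN // subrr.
    rewrite convB -(conv_indep hq hqN) -(conv_indep (hn (T al a)) hTN) hX -conv_deriv // hX.
    rewrite y_T -yT; apply/eqP; rewrite subr_eq0; apply/eqP/funext => k.
    by rewrite /ps_map /ps_deriv linearMn.
  by move/eqP; rewrite subr_eq0 => /eqP <-; rewrite /q addrC addKr.
move=> a m; elim/mi_ind: m a => [|m al IHm] a; first by rewrite Xz0 expad0.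
by apply: (@lmod_mulrSI _ _ (m al)); rewrite /= Xrec expad_rec !IHm.
Qed.

End ExponentialSeries.

(** * Scalars, differences and derivatives of classes *)

Section LocComplements.
Variables (K : numFieldType) (d : nat) (W : lmodType K).
Local Notation D := d.+1.
Implicit Types x y : loc D W.

Lemma locqZ (c : K) x : locq (loc_map ( *:%R c) x) = c *: locq x.
Proof. by case: x => N f; rewrite -[RHS]/(c *: frac N f) -linearZ. Qed.

Lemma locqB x y : locq (loc_sub x y) = locq x - locq y.
Proof. by rewrite locqD; case: y => N f; rewrite -[RHS]/(_ - frac N f) -linearN. Qed.

Lemma lmap_sum (W' : lmodType K) (I : Type) (r : seq I) (Q : pred I)
    (F : {linear W -> W'}) (G : I -> {linear W -> W'}) (x : Loc d W) :
  (forall w, F w = \sum_(i <- r | Q i) G i w) ->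
  lmap F x = \sum_(i <- r | Q i) lmap (G i) x.
Proof.
move=> h; have [N [f ->]] := LocP x.
rewrite lmapE (eq_bigr _ (fun i _ => lmapE (G i) N f)) -linear_sum; congr frac.
by rewrite fct_sumE; apply/funext => m; rewrite /ps_map h.
Qed.

Lemma locq_deriv al x (g : ps D W) :
  locq x = frac 0 g -> locq (loc_deriv al x) = frac 0 (ps_deriv al g).
Proof.
case: x => N f /frac_eq /= ->; apply/frac_eq; transitivity (iter N.+1 (@ps_z2 D W) (ps_deriv al g)) => //.
have /eqP := ps_deriv_iter_z2 al N g; rewrite -subr_eq => /eqP <-.
by apply/funext => m; rewrite /= -fct_Mn.
Qed.

End LocComplements.

(** * Parity projections of vectors and operators *)

Section Parity.
Variables (K : numFieldType) (V : lmodType K) (P : {linear V -> V}).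
Hypothesis PK : is_parity P.
Local Notation sg i := (psign K i).

Lemma psignM i j : sg i * sg j = sg (i (+) j).
Proof. by case: i; case: j; rewrite /psign /= ?mulN1r ?opprK ?mul1r. Qed.

Lemma half_add (v : V) : 2^-1 *: (v + v) = v.
Proof.
by rewrite -mulr2n -scaler_nat scalerA mulVf ?scale1r // pnatr_eq0.
Qed.

Lemma sum_par a : \sum_(j : bool) par P j a = a.
Proof.
rewrite big_bool /= /par -scalerDr /psign scale1r scaleN1r addrACA addNr addr0.
exact: half_add.
Qed.

Lemma P_par j a : P (par P j a) = sg j *: par P j a.
Proof.
rewrite /par linearZ linearD linearZ /= PK scalerA mulrC -scalerA; congr (_ *: _).
by rewrite scalerDr scalerA psignM addbb scale1r addrC.
Qed.

Fact par_is_linear j : linear (par P j).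
Proof.
move=> c u v; rewrite /par linearP scalerA [c * _]mulrC -(scalerA _ c) -scalerDr.
congr (_ *: _); rewrite scalerDr scalerA [_ * c]mulrC -(scalerA c) scalerDr.
by rewrite addrACA.
Qed.
HB.instance Definition _ j := GRing.isLinear.Build K V V *:%R (par P j) (par_is_linear j).

Variable X : {linear V -> V}.

Fact opar_is_linear i : linear (opar P i X).
Proof.
move=> c u v; rewrite /opar (linearP P) !(linearP X) (linearP P).
rewrite scalerA [c * _]mulrC -(scalerA _ c) -scalerDr.
congr (_ *: _); rewrite scalerDr scalerA [_ * c]mulrC -(scalerA c) scalerDr.
by rewrite addrACA.
Qed.
HB.instance Definition _ i := GRing.isLinear.Build K V V *:%R (opar P i X) (opar_is_linear i).

Lemma sum_opar v : \sum_(i : bool) opar P i X v = X v.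
Proof.
rewrite big_bool /= /opar -scalerDr /psign scale1r scaleN1r addrACA addNr addr0.
exact: half_add.
Qed.

Lemma P_opar i v : P (opar P i X v) = sg i *: opar P i X (P v).
Proof.
rewrite /opar linearZ linearD linearZ /= !PK scalerA [sg i * _]mulrC -scalerA; congr (_ *: _).
by rewrite scalerDr scalerA psignM addbb scale1r addrC.
Qed.

End Parity.

(** * Fields of a vertex algebra *)

Section Fields.
Variables (K : numFieldType) (V : lmodType K) (d : nat).
Local Notation D := d.+1.
Variables (P : {linear V -> V}) (T : 'I_D -> {linear V -> V}).
Variables (Y : V -> V -> loc D V) (one : V).
Hypothesis VA : is_vertex_algebra P T Y one.

Definition Yq a b : Loc d V := locq (Y a b).

Let PK : is_parity P. Proof. by case: VA. Qed.

Fact Yq_linear_l b : linear (Yq^~ b).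
Proof.
by case: VA => _ [h _] c u v; rewrite /Yq; have /locqE -> := h c u v b; rewrite locqD locqZ.
Qed.

Fact Yq_linear_r a : linear (Yq a).
Proof.
by case: VA => _ [_ [h _]] c u v; rewrite /Yq; have /locqE -> := h c a u v; rewrite locqD locqZ.
Qed.
HB.instance Definition _ a := GRing.isLinear.Build K V (Loc d V) *:%R (Yq a) (Yq_linear_r a).

Definition Yql b : {linear V -> Loc d V} := HB.pack (Yq^~ b)
  (GRing.isLinear.Build K V (Loc d V) *:%R (Yq^~ b) (Yq_linear_l b)).

Lemma Yq_suml (I : Type) (r : seq I) (Q : pred I) F b :
  Yq (\sum_(i <- r | Q i) F i) b = \sum_(i <- r | Q i) Yq (F i) b.
Proof. exact: (linear_sum (Yql b)). Qed.

Lemma YqZl c a b : Yq (c *: a) b = c *: Yq a b.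
Proof. exact: (linearZZ (Yql b)). Qed.

Lemma Yq_P a b : lmap P (Yq a b) = Yq (P a) (P b).
Proof.
case: VA => _ [_ [_ [h _]]]; rewrite /Yq; have /locqE -> := h a b.
by rewrite -locq_map.
Qed.

Lemma Yq_one a : Yq one a = frac 0 (fun m => if m == mi0 D then a else 0).
Proof. by case: VA => _ [_ [_ [_ [_ [_ [_ [_ [_ [_ [/(_ a)/locqE h _]]]]]]]]]]. Qed.

Lemma one_even : P one = one.
Proof. by case: VA => _ [_ [_ [_ [_ [_ [_ [_ [h _]]]]]]]]. Qed.

Lemma T_one al : T al one = 0.
Proof. by case: VA => _ [_ [_ [_ [_ [_ [_ [_ [_ [h _]]]]]]]]]. Qed.

Lemma T_comm al be v : T al (T be v) = T be (T al v).
Proof. by case: VA => _ [_ [_ [_ [h _]]]]. Qed.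

Lemma Yq_T al a b (g h : ps D V) : Yq a b = frac 0 g -> Yq a (T al b) = frac 0 h ->
  ps_deriv al g = ps_map (T al) g - h.
Proof.
case: VA => _ [_ [_ [_ [_ [_ [_ [/(_ al a b)/locqE cov _]]]]]]] hg hh.
apply: (@frac_inj K d V 0); rewrite linearB -(locq_deriv al hg) -cov locqB locq_map.
by rewrite -[locq (Y a b)]/(Yq a b) -[locq (Y a _)]/(Yq a _) hg hh lmapE.
Qed.

Lemma state_exists a : exists f, Yq a one = frac 0 f /\ f (mi0 D) = a.
Proof.
case: VA => _ [_ [_ [_ [_ [_ [_ [_ [_ [_ [_ /(_ a)]]]]]]]]]] [f [/locqE h fa]].
by exists f.
Qed.

Definition state : V -> ps D V := projT1 (boolp.choice state_exists).

Lemma Yq_state a : Yq a one = frac 0 (state a).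
Proof. by case: (projT2 (boolp.choice state_exists) a). Qed.

Lemma state0 a : state a (mi0 D) = a.
Proof. by case: (projT2 (boolp.choice state_exists) a). Qed.

Fact state_is_linear : linear state.
Proof.
by move=> c a b; apply: (@frac_inj K d V 0); rewrite linearP /= -!Yq_state; apply: Yq_linear_l.
Qed.
HB.instance Definition _ := GRing.isLinear.Build K V (ps D V) *:%R state state_is_linear.

(** As T_al kills the vacuum, translation covariance at 1 reduces to the equation defining e^{z.T}
    a. *)
Lemma state_deriv al a : ps_deriv al (state a) = ps_map (T al) (state a).
Proof.
have h : Yq a (T al one) = frac 0 0 by rewrite T_one !linear0.
by rewrite (Yq_T (Yq_state a) h) subr0.
Qed.

Lemma Yq_local_homog i j a b : homog P i a -> homog P j b ->
  mutually_local (fun c => lmap (Yq a) (Yq b c))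
                 (fun c => ssign K i j *: lmap (Yq b) (Yq a c)).
Proof.
case: VA => _ [_ [_ [_ [_ [_ [h _]]]]]] ha hb; have [N hN] := h i j a b ha hb.
have itq_YY a' b' c : itq (YY Y a' b' c) = lmap (Yq a') (Yq b' c).
  exact: (locq_map (Yq a') (Y b' c)).
exists N => c; have [L [G [L' [G' [/itqE e /itqE e' hG]]]]] := hN c.
rewrite linearZ /= -!itq_YY -!itq_crossN e e' !itq_emb_w.
(* The axiom supplies separate fractions for the two products; both are raised to the common
   exponent L + L'. *)
exists (L + L')%N, (iter L' (@ps2_z2w2 D V) G); split; first by rewrite emb_raise.
rewrite (iter_comm _ (@swap_z2w2 K d V)) -(emb_raise L) addnC -linearZ.
congr emb.
have -> : iter L' (@ps2_z2w2 D V) (ps2_swap G) = ps2_swap (iter L' (@ps2_z2w2 D V) G).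
  by rewrite (iter_comm _ (@swap_z2w2 K d V)).
apply/funext => m; apply/funext => p; rewrite /ps2_swap hG.
by rewrite -(iter_comm _ (@swap_z2w2 K d V)).
Qed.

Lemma homog_par j a : homog P j (par P j a).
Proof. exact: P_par. Qed.

(** The locality axiom speaks of homogeneous vectors only; arbitrary a and b are split by parity and
    the four cases are added. *)
Lemma Yq_local a b :
  mutually_local (fun c => lmap (Yq a) (Yq b c))
    (fun c => \sum_(k : bool) \sum_(l : bool)
       ssign K k l *: lmap (Yq (par P l b)) (Yq (par P k a) c)).
Proof.
rewrite (_ : (fun c => lmap _ _) = fun c => \sum_(k : bool) \sum_(l : bool)
    lmap (Yq (par P k a)) (Yq (par P l b) c)).
  apply: mlocal_sum => k _; apply: mlocal_sum => l _.
  exact: Yq_local_homog (homog_par _ _) (homog_par _ _).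
apply/funext => c.
rewrite (lmap_sum (r := index_enum _) (Q := xpredT) (G := fun k => Yq (par P k a))).
  apply: eq_bigr => k _; rewrite -linear_sum; congr (lmap _ _).
  by rewrite -Yq_suml (sum_par P).
by move=> v; rewrite -Yq_suml (sum_par P).
Qed.

(** * Fields Y(p(z), z) with p a polynomial *)

Section Polynomial.
Variables (p : mi D -> V) (n : nat).

Definition Yp b : Loc d V := locq (Ypoly Y p n b).

Lemma YpE b : Yp b = \sum_(k : {ffun 'I_D -> 'I_n.+1}) lsh (mk_mi k) (Yq (p (mk_mi k)) b).
Proof. by rewrite /Yp locq_sum; apply: eq_bigr => k _; rewrite locq_shift. Qed.

Fact Yp_is_linear : linear Yp.
Proof.
move=> c u v; rewrite !YpE scaler_sumr -big_split; apply: eq_bigr => k _ /=.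
by rewrite !linearP.
Qed.
HB.instance Definition _ := GRing.isLinear.Build K V (Loc d V) *:%R Yp Yp_is_linear.

Lemma Yp_one : Yp one = frac 0 (conv state n p).
Proof.
rewrite YpE /conv -(box_sum n (fun k => ps_shift k (state (p k)))) linear_sum.
by apply: eq_bigr => k _; rewrite Yq_state lshE.
Qed.

End Polynomial.

Definition par_poly k (p : mi D -> V) m := par P k (p m).

(** Since P Y(a,z) P = Y(Pa,z), projecting the coefficients of p is the same as projecting the field
    as an operator. *)
Lemma Yp_par k p n b :
  Yp (par_poly k p) n b = 2^-1 *: (Yp p n b + psign K k *: lmap P (Yp p n (P b))).
Proof.
rewrite !YpE linear_sum scaler_sumr -big_split scaler_sumr; apply: eq_bigr => m _.
rewrite /= lmap_lsh Yq_P PK -linearZ -linearD -linearZ; congr lsh.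
by rewrite -YqZl -[LHS]/(Yql b _) -[_ + _]/(Yql b _ + Yql b _) -linearD -linearZ.
Qed.

(** Locality survives finite sums and multiplication by z^k; the latter is an inner shift in one
    product and an outer shift in the other. *)
Lemma Yp_local p n b :
  mutually_local (fun c => lmap (Yp p n) (Yq b c))
    (fun c => \sum_(k : bool) \sum_(l : bool)
       ssign K k l *: lmap (Yq (par P l b)) (Yp (par_poly k p) n c)).
Proof.
rewrite (_ : (fun c => lmap _ _) = fun c => \sum_(k : {ffun 'I_D -> 'I_n.+1})
    lmap (@lsh K d V (mk_mi k)) (lmap (Yq (p (mk_mi k))) (Yq b c))).
  rewrite (_ : (fun c => \sum_(k : bool) _) = fun c => \sum_(m : {ffun 'I_D -> 'I_n.+1})
      lsh (mk_mi m) (\sum_(k : bool) \sum_(l : bool)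
        ssign K k l *: lmap (Yq (par P l b)) (Yq (par P k (p (mk_mi m))) c))).
    apply: mlocal_sum => m _; apply: mlocal_shift; exact: Yq_local.
  apply/funext => c; rewrite [RHS](eq_bigr _ (fun m _ => linear_sum _ _ _ _)) [RHS]exchange_big /=.
  apply: eq_bigr => k _; rewrite [RHS](eq_bigr _ (fun m _ => linear_sum _ _ _ _)) [RHS]exchange_big /=.
  apply: eq_bigr => l _; rewrite YpE linear_sum scaler_sumr; apply: eq_bigr => m _.
  by rewrite linearZ /= lmap_lsh.
apply/funext => c.
rewrite (lmap_sum (r := index_enum _) (Q := xpredT)
  (G := fun k : {ffun 'I_D -> 'I_n.+1} =>
     (@lsh K d V (mk_mi k) \o Yq (p (mk_mi k)) : {linear V -> Loc d V}))).
  by apply: eq_bigr => k _; symmetry; apply: lmap_comp.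
by move=> v; rewrite -[LHS]/(Yp p n v) YpE.
Qed.

(** * The bracket [X, Y(a,z)] *)

Section Bracket.
Variable X : {linear V -> V}.

Definition br_homog i j a b : Loc d V :=
  lmap (opar P i X) (Yq (par P j a) b) - ssign K i j *: Yq (par P j a) (opar P i X b).

Definition br a b : Loc d V := locq (brXY P Y X a b).
Definition br_par k a b : Loc d V := locq (brXY_k P Y X k a b).

Lemma locq_br_homog i j a b :
  locq (loc_sub (loc_map (opar P i X) (Y (par P j a) b))
          (loc_map ( *:%R (ssign K i j)) (Y (par P j a) (opar P i X b)))) = br_homog i j a b.
Proof. by rewrite locqB locqZ (locq_map (opar P i X)). Qed.

Lemma brE a b : br a b = \sum_(i : bool) \sum_(j : bool) br_homog i j a b.
Proof.
rewrite /br locq_sum; apply: eq_bigr => i _; rewrite locq_sum.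
by apply: eq_bigr => j _; apply: locq_br_homog.
Qed.

Lemma br_parE k a b :
  br_par k a b = \sum_(i : bool) \sum_(j : bool | addb i j == k) br_homog i j a b.
Proof.
rewrite /br_par locq_sum; apply: eq_bigr => i _; rewrite locq_sum.
by apply: eq_bigr => j _; apply: locq_br_homog.
Qed.

Fact br_is_linear a : linear (br a).
Proof.
move=> c u v; rewrite !brE scaler_sumr -big_split; apply: eq_bigr => i _ /=.
rewrite scaler_sumr -big_split; apply: eq_bigr => j _ /=.
rewrite /br_homog (linearP (opar P i X)) !(linearP (Yq _)) (linearP (lmap _)) /=.
by rewrite scalerBr scalerDr scalerA [_ * c]mulrC -(scalerA c) opprD addrACA.
Qed.
HB.instance Definition _ a := GRing.isLinear.Build K V (Loc d V) *:%R (br a) (br_is_linear a).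

Lemma lmap_P_opar i (x : Loc d V) :
  lmap P (lmap (opar P i X) x) = psign K i *: lmap (opar P i X) (lmap P x).
Proof.
have [N [f ->]] := LocP x; rewrite !lmapE -linearZ; congr frac.
by apply/funext => m; apply: (P_opar PK).
Qed.

Lemma br_homog_P i j a b :
  lmap P (br_homog i j a (P b)) = psign K (i (+) j) *: br_homog i j a b.
Proof.
have P_Yq v : lmap P (Yq (par P j a) v) = psign K j *: Yq (par P j a) (P v).
  by rewrite Yq_P (P_par PK) YqZl.
rewrite /br_homog linearB linearZ /= lmap_P_opar !P_Yq (P_opar PK) !PK.
rewrite (linearZZ (Yq _)) (linearZZ (lmap _)) -psignM scalerBr !scalerA.
by congr (_ - _ *: _); rewrite mulrC (mulrC (ssign K i j)) mulrA.
Qed.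

(** Conjugation by P multiplies the (i, j) piece of the bracket by (-1)^(i+j), so averaging isolates
    parity k. Components are thus known from the whole bracket at b and P b. *)
Lemma br_par_half k a b :
  br_par k a b = 2^-1 *: (br a b + psign K k *: lmap P (br a (P b))).
Proof.
rewrite br_parE !brE linear_sum scaler_sumr -big_split scaler_sumr.
apply: eq_bigr => i _; rewrite linear_sum scaler_sumr -big_split scaler_sumr.
rewrite [LHS]big_mkcond; apply: eq_bigr => j _ /=.
rewrite br_homog_P scalerA psignM; case: eqP => [->|/eqP ne].
  by rewrite addbb scale1r half_add.
rewrite (_ : k (+) (i (+) j) = true) ?scaleN1r ?subrr ?scaler0 //.
by move: ne; case: k; case: (i (+) j).
Qed.

Lemma br_par_Yp k a p n c :
  br a c = Yp p n c -> br a (P c) = Yp p n (P c) ->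
  br_par k a c = Yp (par_poly k p) n c.
Proof. by move=> e e'; rewrite br_par_half e e' Yp_par. Qed.

Lemma br_one_l b : br one b = 0.
Proof.
have par1 : par P true one = 0 by rewrite /par one_even /psign scaleN1r subrr scaler0.
have par0 : par P false one = one by rewrite /par one_even /psign scale1r half_add.
rewrite brE big1 // => i _; rewrite big_bool /= /br_homog par0 par1.
have Y0 c : Yq 0 c = 0 by exact: (linear0 (Yql c)).
rewrite !Y0 (linear0 (lmap _)) scaler0 subr0 add0r !Yq_one lmapE /ssign andbF scale1r.
apply/eqP; rewrite subr_eq0; apply/eqP; congr frac; apply/funext => m.
by rewrite /ps_map; case: ifP => // _; rewrite linear0.
Qed.

(** The vacuum is even, so both parity components of X kill it and only the terms X Y(a,z)1
    survive. *)
Lemma br_one_r a : X one = 0 -> br a one = frac 0 (ps_map X (state a)).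
Proof.
move=> X1; have O i : opar P i X one = 0.
  by rewrite /opar one_even X1 linear0 scaler0 addr0 scaler0.
rewrite -lmapE -Yq_state brE.
rewrite (lmap_sum (r := index_enum _) (Q := xpredT) (G := fun i => opar P i X)) => [|v]; last first.
  by rewrite (sum_opar P).
apply: eq_bigr => i _; rewrite -[in RHS](sum_par P a) Yq_suml linear_sum.
by apply: eq_bigr => j _; rewrite /br_homog O linear0 scaler0 subr0.
Qed.

Lemma itq_term1 a b c : itq (term1 P Y X a b c) = lmap (br a) (Yq b c).
Proof. exact: (locq_map (br a) (Y b c)). Qed.

Lemma itq_term2 a b c : itq (term2 P Y X a b c) =
  \sum_(k : bool) \sum_(l : bool) ssign K k l *: lmap (Yq (par P l b)) (br_par k a c).
Proof.
rewrite itq_sum; apply: eq_bigr => k _; rewrite itq_sum; apply: eq_bigr => l _.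
rewrite /br_par; case: (brXY_k P Y X k a c) => N f.
rewrite -[locq _]/(frac N f) lmapE -linearZ; congr frac.
by apply/funext => m; apply: locqZ.
Qed.

Lemma local_opE : local_op P Y X <-> forall a b, mutually_local
  (fun c => lmap (br a) (Yq b c))
  (fun c => \sum_(k : bool) \sum_(l : bool)
      ssign K k l *: lmap (Yq (par P l b)) (br_par k a c)).
Proof.
split=> h a b; have [N hN] := h a b; exists N => c; have [L [G [h1 h2]]] := hN c; exists L, G.
  move: h1 h2 => /itqE + /itqE; rewrite !itq_crossN itq_term1 itq_term2.
  by rewrite itq_emb_w itq_emb_z.
by split; apply/itqE; rewrite itq_crossN ?itq_term1 ?itq_term2 ?itq_emb_w ?itq_emb_z.
Qed.

(** Locality is transferred from Y(X(z)a,z); the parity components in the opposite product agree by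
    [br_par_Yp]. *)
Lemma br_local (Xz : V -> mi D -> V) (n : V -> nat) :
  (forall a b, br a b = Yp (Xz a) (n a) b) -> local_op P Y X.
Proof.
move=> h; apply/local_opE => a b; have [N hN] := Yp_local (Xz a) (n a) b.
exists N => c; rewrite (eq_lmap (F := br a) (G := Yp (Xz a) (n a)) _ (h a)).
rewrite (eq_bigr (fun k => \sum_(l : bool) ssign K k l *:
  lmap (Yq (par P l b)) (Yp (par_poly k (Xz a)) (n a) c))) => [|k _]; first exact: hN.
by apply: eq_bigr => l _; rewrite (br_par_Yp k (h a c) (h a (P c))).
Qed.

(* Goddard uniqueness: both fields are local with respect to every Y(b,w) and agree on
   the vacuum, so they agree on Y(b,w)1, hence on b = Y(b,w)1 at w = 0. *)
Lemma br_unique a p n :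
  local_op P Y X -> br a one = Yp p n one -> forall b, br a b = Yp p n b.
Proof.
move=> /local_opE loc e b; have [N hN] := loc a b; have [N' hN'] := Yp_local p n b.
have h1 := same_series_cross N' (hN one); have h2 := same_series_cross N (hN' one).
(* Evenness of the vacuum upgrades agreement on 1 to agreement of each parity component on 1. *)
have e' : br a (P one) = Yp p n (P one) by rewrite one_even.
move: h1; rewrite (eq_bigr (fun k => \sum_(l : bool)
  ssign K k l *: lmap (Yq (par P l b)) (Yp (par_poly k p) n one))) => [h1|k _]; last first.
  by apply: eq_bigr => l _; rewrite (br_par_Yp k e e').
move: h1 h2; rewrite -!iterD addnC => h1 h2.
have /iter_cross_inj := same_series_inj h1 h2.
rewrite Yq_state !lmapE => /frac_inj /(congr1 (fun f => f (mi0 D))).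
by rewrite /ps_map state0.
Qed.

End Bracket.
End Fields.

Section Main.
Variables (K : numFieldType) (V : lmodType K) (d : nat).
Local Notation D := d.+1.
Variables (P : {linear V -> V}) (T : 'I_D -> {linear V -> V}).
Variables (Y : V -> V -> loc D V) (one : V).
Hypothesis VA : is_vertex_algebra P T Y one.
Variable X : {linear V -> V}.

Lemma cond_i_formula : cond_i P T Y one X -> forall a, exists n : nat,
  (forall m, (n < mi_deg m)%N -> expad T X m a = 0) /\
  (forall b, loc_eq (brXY P Y X a b) (Ypoly Y (fun m => expad T X m a) n b)).
Proof.
move=> [Xloc X1 poly]; have [n hn] := boolp.choice poly.
move=> a; exists (n a); split=> [|b]; first exact: hn.
apply/locqE/(br_unique VA Xloc).
rewrite (br_one_r VA) // (Yp_one VA).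
by rewrite (conv_expad (T_comm VA) (state0 VA) (state_deriv VA) hn).
Qed.

Lemma is_Xz_expad Xz : is_Xz P Y X Xz ->
  [/\ local_op P Y X, X one = 0 & forall a m, Xz a m = expad T X m a].
Proof.
move=> [_ Xz0 /boolp.choice[n hn]].
have brYp a b : br P Y X a b = Yp Y (Xz a) (n a) b by apply/locqE; apply: (hn a).2.
(* For a = 1 the bracket vanishes because Y(1,z) is the identity; hence Y(X(z)1,z)1 = 0, and its
   constant term is X(0)1 = X1. *)
have X1 : X one = 0.
  rewrite -Xz0 -(conv_0 (state0 VA) (n one)).
  have := br_one_l VA X one; rewrite brYp (Yp_one VA) -[RHS](linear0 (@frac K d V 0)).
  by move/frac_inj ->.
split=> //; first exact: (br_local VA brYp).
apply: (conv_expad_unique (T_comm VA) (state0 VA) (state_deriv VA) Xz0) => a; first exact: (hn a).1.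
by apply: (@frac_inj K d V 0); rewrite -(Yp_one VA) -brYp (br_one_r VA).
Qed.

Lemma cond_ii_iff : cond_i P T Y one X <-> cond_ii P Y X.
Proof.
split=> [h | [Xz hXz]].
  exists (fun a m => expad T X m a); split=> [m k u v|a|]; [|exact: expad0|exact: cond_i_formula].
  exact: expad_is_linear.
have [loc X1 XzE] := is_Xz_expad hXz; split=> // a.
have [_ _ /(_ a)[n [hn _]]] := hXz; exists n => m hm; rewrite -XzE; exact: hn.
Qed.

End Main.

Theorem mainTheorem1 (K : numClosedFieldType) (V : lmodType K) (D : nat)
  (P : {linear V -> V}) (T : 'I_D -> {linear V -> V})
  (Y : V -> V -> loc D V) (one : V) (X : {linear V -> V}) :
  (0 < D)%N ->
  is_vertex_algebra P T Y one ->
  [/\ (cond_i P T Y one X <-> cond_ii P Y X),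
      (forall Xz : V -> mi D -> V, is_Xz P Y X Xz ->
         forall a m, Xz a m = expad T X m a) &
      (cond_i P T Y one X ->
         forall a, exists n : nat,
           (forall m, (n < mi_deg m)%N -> expad T X m a = 0) /\
           (forall b, loc_eq (brXY P Y X a b) (Ypoly Y (fun m => expad T X m a) n b)))].
Proof.
case: D T Y => [//|d] T Y _ VA; split.
- exact: cond_ii_iff.
- by move=> Xz /(is_Xz_expad VA)[].
- exact: cond_i_formula.
Qed.
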